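(* Let $K\ge2$, $\gamma\in(0,1)$, $\alpha\in(1,e/2]$ and $\mu\in\mathcal G^*$. Let $R=R(K,\alpha)>0$ be the constant in the threshold $\beta(t,\delta)=\log(Rt^\alpha/\delta)$. Then the stopping times $\tau_\delta$ of the Exploration-Biased Sampling strategy with parameters $\delta,\gamma$ and threshold $\beta$ satisfy $$\limsup_{\delta\to0}\frac{\mathbb E_\mu[\tau_\delta]}{\log(1/\delta)}\le\alpha\,T(\mu).$$
   Context: Bandits. $[K]=\{1,\dots,K\}$. $\mathcal G$ is the set of Gaussian bandits with $K$ arms, unit variances and means $\mu\in[0,1]^K$; arm $a$ has law $\mathcal N(\mu_a,1)$. $\mathcal G^*\subset\mathcal G$ is the set of $\mu$ whose maximal coordinate is attained at a unique arm $a^*(\mu)$. $\Sigma_K=\{v\in[0,1]^K:\sum_a v_a=1\}$. For $\mu\in\mathcal G^*$, $\mathrm{Alt}(\mu)=\{\lambda\in\mathcal G^*:a^*(\lambda)\ne a^*(\mu)\}$ and $$T(\mu)^{-1}=\sup_{v\in\Sigma_K}\inf_{\lambda\in\mathrm{Alt}(\mu)}\sum_{a\in[K]}v_a\frac{(\mu_a-\lambda_a)^2}{2}=\sup_{v\in\Sigma_K}\frac12\min_{a\ne a^*(\mu)}\frac{v_{a^*(\mu)}v_a}{v_{a^*(\mu)}+v_a}(\mu_{a^*(\mu)}-\mu_a)^2 ;$$ $w(\mu)\in\Sigma_K$ is the unique maximizer $v$. If $\mu$ has several maximal arms, $w(\mu)$ is the uniform distribution on the set of maximal arms. The same definition (last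 formula) is used for $w(\nu)$ with $\nu\in\mathbb R^K$. Exploration-Biased Weights. Input: a product of intervals $\prod_{a}[\underline\mu_a,\overline\mu_a]$. Put $\mathrm{maxLB}=\max_a\underline\mu_a$, $\mathrm{minUB}=\min_a\overline\mu_a$. If $\mathrm{minUB}\ge\mathrm{maxLB}$, output $\tilde\mu=(\mathrm{minUB},\dots,\mathrm{minUB})$ and $w=(1/K,\dots,1/K)$. Otherwise, for each $a$ with $\overline\mu_a>\mathrm{maxLB}$ let $\tilde\mu^{(a)}$ be the vector with $\tilde\mu^{(a)}_a=\overline\mu_a$ and $\tilde\mu^{(a)}_b=\max(\underline\mu_b,\mathrm{minUB})$ for $b\ne a$; output a $\tilde\mu=\tilde\mu^{(a)}$ maximizing $\min_b w_b(\tilde\mu^{(a)})$ over such $a$ (the first one in case of ties) together with $w=w(\tilde\mu)$. Exploration-Biased Sampling with parameters $\delta,\gamma\in(0,1)$ and threshold $\beta(t,\delta)$. At each time $t$ an arm $A_t$ is chosen from past observations and an independent draw $Y_t\sim\mathcal N(\mu_{A_t},1)$ is observed. $N_a(t)=\sum_{s=1}^t\mathbf 1_{A_s=a}$, $\hat\mu_a(t)=N_a(t)^{-1}\sum_{s=1}^tY_s\mathbf 1_{A_s=a}$. Each arm is observed once during the first $K$ rounds; $\tilde w(s)=(1/K,\dots,1/K)$ for $0\le s\le K-1$. For $t\ge K$ let $\mathcal{CR}_\mu(t)=\prod_a[\hat\mu_a(t)-C_{\gamma/K}(N_a(t)),\hat\mu_a(t)+C_{\gamma/K}(N_a(t))]$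 with $C_\gamma(s)=2\sqrt{\log(4s/\gamma)/s}$, let $(\tilde\mu(t),\tilde w(t))$ be the output of Exploration-Biased Weights on $\mathcal{CR}_\mu(t)$, and choose $A_{t+1}\in\arg\min_a\bigl(N_a(t)-\sum_{s=1}^t\tilde w_a(s)\bigr)$. With $$Z_{a,b}(t)=\tfrac12\tfrac{N_a(t)N_b(t)}{N_a(t)+N_b(t)}(\hat\mu_a(t)-\hat\mu_b(t))|\hat\mu_a(t)-\hat\mu_b(t)|,\qquad Z(t)=\max_a\min_{b\ne a}Z_{a,b}(t),$$ the strategy stops at $\tau_\delta=\inf\{t\ge K:Z(t)>\beta(t,\delta)\}$ and outputs $\arg\max_a\hat\mu_a(\tau_\delta)$. $\mathbb E_\mu$ refers to the bandit with means $\mu$. *)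

(* Defs.v *)
From HB Require Import structures.
From mathcomp Require Import all_boot all_order all_algebra.
From mathcomp Require Import all_classical all_reals all_analysis.

Set Implicit Arguments.
Unset Strict Implicit.
Unset Printing Implicit Defensive.

Import Order.TTheory GRing.Theory Num.Theory.
Import numFieldNormedType.Exports.

Local Open Scope classical_set_scope.
Local Open Scope ring_scope.

(* Arms are the elements of 'I_K. For 2 <= K, every [sup] and [inf] below over
   all arms, or over all arms but one, ranges over a nonempty finite set of
   reals and is thus a maximum or a minimum. *)

Section Bandits.
Context {R : realType} {K : nat}.
Implicit Types (mu nu lam v : 'I_K -> R) (a b : 'I_K).

(* [Some a] when the maximum is attained at [a] only, [None] when it is attained
   several times. *)
Definition best_arm nu : option 'I_K :=
  [pick a | [forall b, (b != a) ==> (nu b < nu a)]].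

Definition bandits : set ('I_K -> R) := [set mu | forall a, 0 <= mu a <= 1].

Definition bandits_star : set ('I_K -> R) :=
  [set mu | bandits mu /\ best_arm mu != None].

Definition simplex : set ('I_K -> R) :=
  [set v | (forall a, 0 <= v a <= 1) /\ \sum_a v a = 1].

Definition Alt mu : set ('I_K -> R) :=
  [set lam | bandits_star lam /\ best_arm lam != best_arm mu].

Definition char_time mu : R :=
  (sup [set inf [set \sum_a v a * ((mu a - lam a) ^+ 2 / 2) | lam in Alt mu]
       | v in simplex])^-1.

(* [a] stands for the best arm of [nu]; the quotient is 0 when v a = v b = 0. *)
Definition gain nu a v : R :=
  2^-1 * inf [set v a * v b / (v a + v b) * (nu a - nu b) ^+ 2
             | b in [set b | b != a]].

Definition opt_weights nu : 'I_K -> R :=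
  match best_arm nu with
  | Some a => get [set v | simplex v /\
                           forall u, simplex u -> gain nu a u <= gain nu a v]
  | None => fun a => let M := [set b : 'I_K | [forall c, nu c <= nu b]]%SET in
                     if a \in M then #|M|%:R^-1 else 0
  end.

Section ExplorationBiasedWeights.
Variables lo hi : 'I_K -> R.

Definition maxLB : R := sup (range lo).

Definition minUB : R := inf (range hi).

Definition biased_means a : 'I_K -> R :=
  fun b => if b == a then hi a else Num.max (lo b) minUB.

Definition min_biased_weight a : R := inf (range (opt_weights (biased_means a))).

(* The first arm, among those with maxLB < hi a, maximizing min_biased_weight. *)
Definition biased_arm : option 'I_K :=
  [pick a | (maxLB < hi a) &&
     [forall b, (maxLB < hi b) ==>
        (min_biased_weight b <= min_biased_weight a) &&
        ((b < a)%N ==> (min_biased_weight b < min_biased_weight a))]].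

(* The case [None] does not occur if lo a < hi a for all a. *)
Definition exploration_biased_weights : ('I_K -> R) * ('I_K -> R) :=
  if maxLB <= minUB then (fun=> minUB, fun=> K%:R^-1)
  else let mut := if biased_arm is Some a then biased_means a
                  else fun=> minUB in
       (mut, opt_weights mut).

End ExplorationBiasedWeights.

Definition conf_width (gamma : R) (s : nat) : R :=
  2 * Num.sqrt (ln (4 * s%:R / gamma) / s%:R).

End Bandits.

(* Rounds are numbered from 1: A s and Y s are the arm chosen and the observation
   made at round s, and their values at s = 0 are never used. *)
Section Sampling.
Context {R : realType} {K : nat} {d : measure_display} {Omega : measurableType d}.
Variables (A : nat -> Omega -> 'I_K) (Y : nat -> Omega -> R).

Definition pulls (a : 'I_K) (t : nat) (w : Omega) : nat :=
  (\sum_(1 <= s < t.+1) (A s w == a))%N.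

Definition emp_mean (a : 'I_K) (t : nat) (w : Omega) : R :=
  (pulls a t w)%:R^-1 * \sum_(1 <= s < t.+1 | A s w == a) Y s w.

(* The sigma-algebra generated by (A_1, Y_1, ..., A_t, Y_t). *)
Definition history (t : nat) : set (set Omega) :=
  <<s [set E | exists s, (0 < s <= t)%N /\
         ((exists a, E = A s @^-1` [set a]) \/
          (exists2 V, measurable V & E = Y s @^-1` V))] >>.

(* A_{t+1} is a function of the past, and Y_{t+1} has law N(mu_{A_{t+1}}, 1)
   conditionally on the past. *)
Record bandit_interaction (P : probability Omega R) (mu : 'I_K -> R) : Prop := {
  arm_from_past : forall t a, history t (A t.+1 @^-1` [set a]);
  obs_measurable : forall t, measurable_fun setT (Y t.+1);
  obs_cond_law : forall t (H : set Omega) a (V : set R),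
    history t H -> measurable V ->
    P (H `&` A t.+1 @^-1` [set a] `&` Y t.+1 @^-1` V) =
    (P (H `&` A t.+1 @^-1` [set a]) * normal_prob (mu a) 1 V)%E
}.

Definition conf_radius (gamma : R) (a : 'I_K) (t : nat) (w : Omega) : R :=
  conf_width (gamma / K%:R) (pulls a t w).

Definition ebs_weights (gamma : R) (t : nat) (w : Omega) : 'I_K -> R :=
  if (t < K)%N then fun=> K%:R^-1
  else (exploration_biased_weights
          (fun a => emp_mean a t w - conf_radius gamma a t w)
          (fun a => emp_mean a t w + conf_radius gamma a t w)).2.

Definition tracking_gap (gamma : R) (t : nat) (w : Omega) (a : 'I_K) : R :=
  (pulls a t w)%:R - \sum_(1 <= s < t.+1) ebs_weights gamma s w a.

Record ebs_sampling (gamma : R) : Prop := {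
  ebs_init : forall a w, pulls a K w = 1%N;
  ebs_tracking : forall t w b, (K <= t)%N ->
    tracking_gap gamma t w (A t.+1 w) <= tracking_gap gamma t w b
}.

Definition Zpair (a b : 'I_K) (t : nat) (w : Omega) : R :=
  let Na := (pulls a t w)%:R in let Nb := (pulls b t w)%:R in
  let D := emp_mean a t w - emp_mean b t w in
  2^-1 * (Na * Nb / (Na + Nb)) * (D * `|D|).

Definition Zstat (t : nat) (w : Omega) : R :=
  sup (range (fun a => inf [set Zpair a b t w | b in [set b | b != a]])).

(* Value +oo if the strategy never stops. *)
Definition stopping_time (beta : nat -> R) (w : Omega) : \bar R :=
  ereal_inf [set t%:R%:E | t in [set t | (K <= t)%N /\ beta t < Zstat t w]].

End Sampling.

Definition threshold {R : realType} (r alpha delta : R) (t : nat) : R :=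
  ln (r * (t%:R `^ alpha) / delta).

(* Main.v *)
Require Import Defs.
From HB Require Import structures.
From mathcomp Require Import all_boot all_order all_algebra.
From mathcomp Require Import all_classical all_reals all_analysis.
From mathcomp Require Import measurable_realfun ring lra.

Set Implicit Arguments.
Unset Strict Implicit.
Unset Printing Implicit Defensive.

Import Order.TTheory GRing.Theory Num.Theory.
Import numFieldNormedType.Exports.

Local Open Scope classical_set_scope.
Local Open Scope ring_scope.

(* Let G be the maximal gain of mu, so that char_time mu >= 1 / G.

   For each horizon T, likelihood-ratio martingales and a union bound show that,
   outside an event of probability O(1/T^2), N_a(t) (hat mu_a(t) - mu_a)^2 <= 8 ln T
   for all arms a and all t <= T. On the complement everything is deterministic.
   The biased weights at time s are at least of order ln s / (s E^2), E being the
   spread of the estimates, so that tracking makes every N_a grow like ln T and,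
   once the spread is thereby bounded, like (ln T)^2: the estimates are then
   uniformly close to mu on all but a vanishing fraction of the rounds. Since
   (x, y) |-> x y / (x + y) is superadditive, the gains of the successive nearly
   optimal weights add up to Z(T) >= th G T for any th < 1 and T large. As
   alpha > 1, one th > 1 / alpha makes the rule stop at T as soon as
   T >= (alpha / G) ln (1 / delta) and T is larger than a constant.

   Hence tau <= (alpha / G) ln (1 / delta) + C + (number of exceptional T), where
   the expectation of the last term is bounded uniformly in delta. *)

(** * Finite minima and optimal weights *)

(** The level [gamma] of the confidence intervals is fixed while [delta] tends to 0, so the proof
    never assumes that they contain [mu]. It uses only their widths, and controls their centres by a
    deviation event whose probability is summable in T, as a bound in expectation requires.

    The difficulty is circular: estimates are accurate only for arms that are pulled often, while
    the pulls follow weights computed from the estimates. The circle is broken by the biased vector,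
    whose smallest weight is bounded below through the ratio of interval width to spread, however
    wrong the estimates are.

    The processes [A] and [Y] may change with [delta], so no constant may depend on them: the
    asymptotic statements fix the starting horizon first and quantify over trajectories last. *)

Section FiniteExtrema.
Context {R : realType} {T : finType}.
Implicit Types (A : set T) (f : T -> R).

(** A crude bound on the image of a finite type, which the real [inf] and [sup] need in order to be
    meaningful. *)
Let norm_le_sum f x : `|f x| <= \sum_y `|f y|.
Proof. by rewrite (bigD1 x)//= lerDl sumr_ge0. Qed.

Lemma inf_image_le A f x : A x -> inf [set f y | y in A] <= f x.
Proof.
move=> Ax; apply: ge_inf; last by exists x.
exists (- \sum_y `|f y|) => _ [y _ <-].
by rewrite lerNl (le_trans _ (norm_le_sum f y))// -normrN ler_norm.
Qed.

Lemma le_inf_image A f c : A !=set0 -> (forall x, A x -> c <= f x) ->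
  c <= inf [set f y | y in A].
Proof.
move=> [x Ax] cf; apply: lb_le_inf; first by exists (f x), x.
by move=> _ [y Ay <-]; exact: cf.
Qed.

Lemma le_sup_image A f x : A x -> f x <= sup [set f y | y in A].
Proof.
move=> Ax; apply: ub_le_sup; last by exists x.
by exists (\sum_y `|f y|) => _ [y _ <-]; rewrite (le_trans (ler_norm _)).
Qed.

Lemma sup_image_le A f c : A !=set0 -> (forall x, A x -> f x <= c) ->
  sup [set f y | y in A] <= c.
Proof.
move=> [x Ax] fc; apply: ge_sup; first by exists (f x), x.
by move=> _ [y Ay <-]; exact: fc.
Qed.

End FiniteExtrema.

(** * The concave, homogeneous function behind the pairwise gains *)

Section HarmonicProduct.
Context {R : realType}.
Implicit Types x y c : R.

(* x / 0 = 0 makes the value at the origin the limit along the quadrant. *)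
Definition hprod x y : R := x * y / (x + y).

Lemma hprod_ge0 x y : 0 <= x -> 0 <= y -> 0 <= hprod x y.
Proof. by move=> x0 y0; rewrite /hprod divr_ge0 ?mulr_ge0 ?addr_ge0. Qed.

Lemma hprod_le_left x y : 0 <= x -> 0 <= y -> hprod x y <= x.
Proof.
move=> x0 y0; rewrite /hprod.
have [xy0|xy0] := eqVneq (x + y) 0; first by rewrite xy0 invr0 mulr0.
have xy : 0 < x + y by rewrite lt_neqAle eq_sym xy0 addr_ge0.
by rewrite ler_pdivrMr// ler_wpM2l// lerDr.
Qed.

Lemma hprodC x y : hprod x y = hprod y x.
Proof. by rewrite /hprod [x * y]mulrC [x + y]addrC. Qed.

Lemma hprod_le_right x y : 0 <= x -> 0 <= y -> hprod x y <= y.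
Proof. by move=> x0 y0; rewrite hprodC hprod_le_left. Qed.

Lemma hprodZ c x y : hprod (c * x) (c * y) = c * hprod x y.
Proof.
rewrite /hprod -mulrDr; have [->|c0] := eqVneq c 0; first by rewrite !mul0r.
have [->|xy0] := eqVneq (x + y) 0; first by rewrite mulr0 !invr0 !mulr0.
by field; rewrite ?c0 ?xy0.
Qed.

Lemma hprod_mono x y x' y' : 0 < x -> 0 < y -> x <= x' -> y <= y' ->
  hprod x y <= hprod x' y'.
Proof.
move=> x0 y0 xx yy; rewrite /hprod.
have x'0 := lt_le_trans x0 xx; have y'0 := lt_le_trans y0 yy.
rewrite ler_pdivrMr ?addr_gt0// mulrAC ler_pdivlMr ?addr_gt0//.
have -> : x' * y' * (x + y) = x * x' * y' + y * y' * x' by ring.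
have -> : x * y * (x' + y') = x * x' * y + y * y' * x by ring.
by rewrite lerD// ler_wpM2l// mulr_ge0// ltW.
Qed.

(** The defect is a square over a product of denominators, and vanishes for proportional pairs. This
    turns a sum of gains over rounds into a gain of the cumulated weights. *)
Lemma hprodD x y x' y' : 0 <= x -> 0 <= y -> 0 <= x' -> 0 <= y' ->
  hprod x y + hprod x' y' <= hprod (x + x') (y + y').
Proof.
move=> x0 y0 x'0 y'0.
have [|xy0] := boolP (x + y == 0).
  rewrite paddr_eq0// => /andP[/eqP-> /eqP->].
  by rewrite !add0r {1}/hprod !mul0r add0r.
have [|xy'0] := boolP (x' + y' == 0).
  rewrite paddr_eq0// => /andP[/eqP-> /eqP->].
  by rewrite !addr0 {2}/hprod !mul0r addr0.
have xy : 0 < x + y by rewrite lt_neqAle eq_sym xy0 addr_ge0.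
have xy' : 0 < x' + y' by rewrite lt_neqAle eq_sym xy'0 addr_ge0.
rewrite /hprod -subr_ge0.
have -> : (x + x') * (y + y') / (x + x' + (y + y'))
   - (x * y / (x + y) + x' * y' / (x' + y')) =
   (x * y' - x' * y) ^+ 2 / ((x + x' + (y + y')) * (x + y) * (x' + y')).
  by field; rewrite xy0 xy'0 /= gt_eqF//; lra.
by rewrite divr_ge0 ?sqr_ge0// !mulr_ge0//; lra.
Qed.

Lemma hprod_sum (I : Type) (s : seq I) (F G : I -> R) :
  (forall i, 0 <= F i) -> (forall i, 0 <= G i) ->
  \sum_(i <- s) hprod (F i) (G i) <= hprod (\sum_(i <- s) F i) (\sum_(i <- s) G i).
Proof.
move=> F0 G0; elim: s => [|i s ih]; first by rewrite !big_nil /hprod !mul0r.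
rewrite !big_cons (le_trans _ (hprodD _ _ _ _))// ?sumr_ge0//.
by rewrite lerD2l.
Qed.

End HarmonicProduct.

(** * Gains, optimal weights and a lower bound on every weight *)

Section Weights.
Context {R : realType} {K : nat}.
Hypothesis hK : (2 <= K)%N.
Implicit Types (nu mu v u : 'I_K -> R) (a b : 'I_K).

Lemma other_arm a : exists b, b != a.
Proof.
case: K hK a => [|[|k]]// _ a.
by exists (lift a ord0); rewrite eq_sym neq_lift.
Qed.

Lemma best_arm_Some nu a :
  best_arm nu = Some a <-> forall b, b != a -> nu b < nu a.
Proof.
rewrite /best_arm; split.
  case: pickP => // c /forallP hc [<-] b ba.
  by have := hc b; rewrite ba.
move=> ha; case: pickP => [c /forallP hc|/(_ a)].
  congr Some; apply/eqP; apply/negPn/negP => ca.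
  by have := hc a; rewrite eq_sym ca /= => /lt_trans /(_ (ha _ ca)); rewrite ltxx.
by move/negbT/negP; case; apply/forallP => b; apply/implyP; exact: ha.
Qed.

Lemma gain_le nu a v b : b != a ->
  gain nu a v <= 2^-1 * (hprod (v a) (v b) * (nu a - nu b) ^+ 2).
Proof.
move=> ba; rewrite /gain ler_wpM2l//.
exact: (@inf_image_le _ _ [set b | b != a]
  (fun b => hprod (v a) (v b) * (nu a - nu b) ^+ 2)).
Qed.

Lemma le_gain nu a v c :
  (forall b, b != a -> c <= 2^-1 * (hprod (v a) (v b) * (nu a - nu b) ^+ 2)) ->
  c <= gain nu a v.
Proof.
move=> h; rewrite /gain -ler_pdivrMl ?invr_gt0// invrK.
apply: (@le_inf_image _ _ [set b | b != a]
  (fun b => hprod (v a) (v b) * (nu a - nu b) ^+ 2)).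
  by have [b ba] := other_arm a; exists b.
move=> b /h; rewrite mulrC -[X in X <= _]mulr1 => ?; lra.
Qed.

(* At a maximizer all the terms of the minimum are equal, say to [y / 2] times
   the weight of the best arm, which leaves the one-dimensional problem of
   maximizing y / (1 + \sum_b y / (g_b - y)) with g_b the squared gaps. *)
Lemma exists_max_gain nu a : best_arm nu = Some a ->
  exists v, simplex v /\ forall u, simplex u -> gain nu a u <= gain nu a v.
Proof.
move=> /best_arm_Some ha.
pose g b := (nu a - nu b) ^+ 2.
have g0 b : b != a -> 0 < g b.
  by move=> /ha nub; rewrite /g exprn_gt0// subr_gt0.
have [b1 b1a] := other_arm a.
have [m ma mP] : exists2 m, m != a & forall b, b != a -> g m <= g b.
  by case: (@arg_minP _ _ _ b1 (fun b => b != a) g b1a) => m ma h; exists m.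
pose S y := \sum_(b | b != a) y / (g b - y).
pose h y := y / (1 + S y).
have gy0 y b : y < g m -> b != a -> 0 < g b - y.
  by move=> ym ba; rewrite subr_gt0 (lt_le_trans ym) ?mP.
have S0 y : 0 <= y < g m -> 0 <= S y.
  move=> /andP[y0 ym]; apply: sumr_ge0 => b ba.
  by rewrite divr_ge0// ltW// gy0.
have ch y : 0 <= y < g m -> {for y, continuous h}.
  move=> /[dup] /S0 Sy /andP[y0 ym]; rewrite /prop_for /continuous_at /h.
  have cS : S z @[z --> y] --> S y.
    rewrite /S; apply: cvg_big => [|b ba]; first exact: add_continuous.
    apply: cvgM; first exact: cvg_id.
    apply: cvgV; first by rewrite gt_eqF// gy0.
    by apply: cvgB; [exact: cvg_cst|exact: cvg_id].
  apply: cvgM; first exact: cvg_id.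
  apply: cvgV; first by rewrite gt_eqF//; lra.
  by apply: cvgD; [exact: cvg_cst|].
have gm := g0 m ma.
have K0 : 0 < K%:R :> R by rewrite ltr0n; apply: leq_trans hK.
have K2 : 2 <= K%:R :> R by rewrite ler_nat.
(* The maximum is sought on the half-open interval from 0 to [g m]. Beyond [y1] the term of [m]
   alone forces h y <= g m - y < g m / (2 K), while at g m / 2 each of the K - 1 terms of [S] is at
   most 1, so that h is at least g m / (2 K). A compact interval is therefore enough. *)
pose y1 := g m - g m / (2 * K%:R).
have gK : g m / (2 * K%:R) <= g m / 4.
  by rewrite ler_pM2l// lef_pV2 ?posrE; lra.
have gK0 : 0 < g m / (2 * K%:R) by rewrite divr_gt0//; lra.
have [||ys ysI ysP] := @EVT_max R h 0 y1.
- by rewrite /y1; lra.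
- apply: continuous_in_subspaceT => y; rewrite inE/= in_itv/= => /andP[y0 yy].
  by apply: ch; rewrite y0/= (le_lt_trans yy)// /y1; lra.
move: ysI; rewrite in_itv/= => /andP[ys0 ysy1].
have ysm : ys < g m by rewrite /y1 in ysy1; lra.
have hmax y : 0 <= y < g m -> h y <= h ys.
  move=> /andP[y0 ym]; have [yy1|yy1] := leP y y1.
    by apply: ysP; rewrite in_itv/= y0.
  have hm2 : g m / (2 * K%:R) <= h (g m / 2).
    rewrite /h invfM mulrA ler_wpM2l//; first by lra.
    have S12 : 0 <= S (g m / 2) by apply: S0; lra.
    rewrite lef_pV2 ?posrE//; last by lra.
    have : \sum_(b | b != a) (g m / 2) / (g b - g m / 2) <= \sum_(b | b != a) 1.
      apply: ler_sum => b ba; have := mP b ba => gb.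
      by rewrite ler_pdivrMr; lra.
    rewrite -/(S _) => /le_trans; rewrite -lerBrDl; apply.
    rewrite (eq_bigl (fun i => i \in predC1 a)); last by move=> i; rewrite inE.
    rewrite sumr_const cardC1 card_ord.
    by rewrite lerBrDr natr1 prednK// (leq_trans _ hK).
  rewrite (le_trans _ (le_trans hm2 (ysP _ _)))//; last first.
    by rewrite in_itv/= /y1; apply/andP; split; lra.
  have Sy : y / (g m - y) <= S y.
    rewrite /S (bigD1 m)//= lerDl sumr_ge0// => b /andP[ba _].
    by rewrite divr_ge0// ltW// gy0.
  have gmy : 0 < g m - y by lra.
  have y00 : 0 < y by rewrite (lt_trans _ yy1)// /y1; lra.
  rewrite /h (@le_trans _ _ (y / (y / (g m - y))))//; last first.
    by rewrite invf_div mulrCA divff ?gt_eqF// mulr1; rewrite /y1 in yy1; lra.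
  rewrite ler_wpM2l ?(ltW y00)// lef_pV2 ?posrE ?divr_gt0//; first by lra.
  by rewrite (lt_le_trans (divr_gt0 y00 gmy))//; lra.
have Sys := S0 ys; rewrite ys0 ysm/= in Sys; have {}Sys := Sys isT.
(* Solving [hprod 1 x * g b = y] for x gives x = y / (g b - y); the factor [c] normalises the
   sum. *)
pose c := (1 + S ys)^-1.
have c0 : 0 < c by rewrite invr_gt0; lra.
pose v b := if b == a then c else c * (ys / (g b - ys)).
have va : v a = c by rewrite /v eqxx.
have vb b : b != a -> v b = c * (ys / (g b - ys)) by rewrite /v => /negbTE->.
have v0 b : 0 <= v b.
  rewrite /v; case: eqVneq => [_|ba]; first exact: ltW.
  by rewrite mulr_ge0 ?(ltW c0)// divr_ge0// ltW// gy0.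
have v1 : \sum_b v b = 1.
  rewrite (bigD1 a)//= va (eq_bigr _ (fun b => vb b)) -big_distrr/= -/(S ys).
  by rewrite -[X in X + _]mulr1 -mulrDr /c mulVf// gt_eqF//; lra.
exists v; split.
  split => // b; rewrite v0/= -v1 (bigD1 b)//= lerDl sumr_ge0//.
have gv : 2^-1 * h ys <= gain nu a v.
  apply: le_gain => b ba; rewrite ler_wpM2l//.
  have := hprodZ c 1 (ys / (g b - ys)); rewrite mulr1 va vb// => ->.
  rewrite -/(g b) /hprod /h.
  have gb := gy0 ys b ysm ba; have gb0 := g0 b ba.
  rewrite le_eqVlt; apply/orP; left; apply/eqP.
  rewrite -/c mulrC -mulrA; congr (_ * _).
  by field; rewrite !gt_eqF//=; lra.
move=> u [u01 u1]; apply: le_trans gv.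
have u0 b : 0 <= u b by have /andP[] := u01 b.
have [gu0|gu0] := leP (gain nu a u) 0.
  by rewrite (le_trans gu0)// mulr_ge0// /h divr_ge0//; lra.
have ua0 : 0 < u a.
  rewrite lt_neqAle u0 andbT; apply/negP => /eqP ua.
  have := gain_le nu u b1a; rewrite -ua /hprod !mul0r mulr0.
  by rewrite leNgt gu0.
(* A competitor [u] is compared with the same family: each u b is at least u a * y / (g b - y), so
   the unit sum bounds u a by 1 / (1 + S y), and twice the gain of [u] is at most h y. *)
pose y := 2 * gain nu a u / u a.
have y0 : 0 < y by rewrite divr_gt0// mulr_gt0.
have yb b : b != a -> y * (u a + u b) <= u b * g b.
  move=> ba; have := gain_le nu u ba.
  rewrite -/(g b) /hprod => hb.
  have uab : 0 < u a + u b by have := u0 b; lra.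
  rewrite -ler_pdivlMr// /y ler_pdivrMr//.
  have -> : u b * g b / (u a + u b) * u a = u a * u b / (u a + u b) * g b by ring.
  lra.
have ym : y < g m.
  have := yb m ma; have := u0 m => um hy.
  rewrite ltNge; apply/negP => gmy.
  have : u m * g m <= u m * y by rewrite ler_wpM2l.
  have : 0 < y * u a by rewrite mulr_gt0.
  by rewrite mulrDr in hy; lra.
have uS : u a * (1 + S y) <= 1.
  rewrite mulrDr mulr1 -[X in _ <= X]u1 [X in _ <= X](bigD1 a)//= lerD2l.
  rewrite /S big_distrr/=.
  apply: ler_sum => b ba; have gb := gy0 y b ym ba.
  rewrite mulrA ler_pdivrMr// mulrBr lerBrDr.
  by have := yb b ba; rewrite mulrDr; lra.
have := hmax y; rewrite ltW//= ym => /(_ isT) hy.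
have yu : 2 * gain nu a u = y * u a by rewrite /y divfK// gt_eqF.
rewrite -ler_pdivrMl// invrK yu (le_trans _ hy)// /h.
rewrite ler_pdivlMr; last by have := S0 y; rewrite ym ltW//= => /(_ isT); lra.
by rewrite -mulrA ler_piMr// ltW.
Qed.

Lemma opt_weights_max nu a : best_arm nu = Some a ->
  simplex (opt_weights nu) /\
  forall u, simplex u -> gain nu a u <= gain nu a (opt_weights nu).
Proof.
by move=> nua; rewrite /opt_weights nua; exact: (getPex (exists_max_gain nua)).
Qed.

Lemma simplex_uniform : simplex (fun _ : 'I_K => K%:R^-1 : R).
Proof.
have K0 : (0 < K)%N by exact: leq_trans hK.
split; last by rewrite sumr_const card_ord -[LHS]mulr_natr mulVf// pnatr_eq0 -lt0n.
by move=> _; rewrite invr_ge0 ler0n/= invf_le1 ?ler1n ?ltr0n.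
Qed.

Lemma opt_weights_simplex nu : simplex (opt_weights nu).
Proof.
case nua : (best_arm nu) => [a|]; first by have [] := opt_weights_max nua.
rewrite /opt_weights nua.
set M := [set b | _]%SET.
have M0 : (0 < #|M|)%N.
  have a0 : 'I_K by case: (K) hK => // n _; exact: ord0.
  have [m _ mP] := @arg_maxP _ _ _ a0 xpredT nu isT.
  by apply/card_gt0P; exists m; rewrite inE; apply/forallP => c; exact: mP.
split.
  move=> a; case: ifP => _; rewrite ?lexx ?ler01//.
  by rewrite invr_ge0 ler0n/= invf_le1 ?ler1n ?ltr0n.
rewrite -big_mkcond/= sumr_const -[LHS]mulr_natr mulVf// pnatr_eq0 -lt0n//.
Qed.

Lemma gain_uniform_ge nu a l : 0 < l -> (forall b, b != a -> l <= nu a - nu b) ->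
  l ^+ 2 / (4 * K%:R) <= gain nu a (fun=> K%:R^-1).
Proof.
move=> l0 hl; apply: le_gain => b ba.
have K0 : 0 < K%:R :> R by rewrite ltr0n; exact: leq_trans hK.
have -> : hprod K%:R^-1 K%:R^-1 = (2 * K%:R)^-1 :> R.
  by rewrite /hprod; field; rewrite gt_eqF.
have -> : l ^+ 2 / (4 * K%:R) = 2^-1 * ((2 * K%:R)^-1 * l ^+ 2).
  by field; rewrite gt_eqF.
rewrite !ler_pM2l ?invr_gt0 ?mulr_gt0// lerXn2r ?nnegrE ?(ltW l0)//; last exact: hl.
by rewrite (le_trans _ (hl b ba))// ltW.
Qed.

(** No arm can be neglected: [hprod] is below each of its arguments, so a small weight on any arm,
    the best one included, makes the gain small, whereas uniform weights already gain l^2 / (4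
    K). *)
Lemma opt_weights_ge nu a l D : best_arm nu = Some a -> 0 < l ->
  (forall b, b != a -> l <= nu a - nu b <= D) ->
  forall b, (l / D) ^+ 2 / (2 * K%:R) <= opt_weights nu b.
Proof.
move=> nua l0 lD.
have [[v01 v1] vmax] := opt_weights_max nua; set v := opt_weights nu in v01 v1 vmax *.
have v0 b : 0 <= v b by have /andP[] := v01 b.
have gv : l ^+ 2 / (4 * K%:R) <= gain nu a v.
  apply: le_trans (vmax _ simplex_uniform).
  by apply: gain_uniform_ge => // b /lD /andP[].
have K0 : 0 < K%:R :> R by rewrite ltr0n; exact: leq_trans hK.
have key b x : b != a -> hprod (v a) (v b) <= x -> (l / D) ^+ 2 / (2 * K%:R) <= x.
  move=> ba hx; have /andP[lb bD] := lD b ba.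
  have D0 : 0 < D by rewrite (lt_le_trans l0)// (le_trans lb).
  have x0 : 0 <= x by rewrite (le_trans _ hx)// hprod_ge0.
  have h1 : l ^+ 2 / (4 * K%:R) <= 2^-1 * (x * D ^+ 2).
    rewrite (le_trans gv)// (le_trans (gain_le nu v ba))// ler_wpM2l//.
    apply: ler_pM => //; first exact: hprod_ge0.
      exact: sqr_ge0.
    rewrite lerXn2r ?nnegrE ?(ltW D0)//.
    by rewrite (le_trans _ lb)// ltW.
  rewrite expr_div_n -ler_pdivlMr ?invr_gt0 ?mulr_gt0// ler_pdivrMr ?exprn_gt0//.
  move: h1; rewrite ler_pdivrMr ?mulr_gt0// invrK.
  by have -> : 2^-1 * (x * D ^+ 2) * (4 * K%:R) = x * (2 * K%:R) * D ^+ 2 by field.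
move=> b; have [->|ba] := eqVneq b a; last first.
  by apply: (key b) => //; exact: hprod_le_right.
by have [c ca] := other_arm a; apply: (key c) => //; exact: hprod_le_left.
Qed.

(** * Weights computed from a box of confidence intervals *)

Section ExplorationBiased.
Variables lo hi : 'I_K -> R.
Hypothesis lohi : forall a, lo a < hi a.

Lemma lo_le_maxLB a : lo a <= maxLB lo.
Proof. by rewrite /maxLB; exact: (@le_sup_image _ _ setT). Qed.

Lemma minUB_le_hi a : minUB hi <= hi a.
Proof. by rewrite /minUB; exact: (@inf_image_le _ _ setT). Qed.

Lemma le_minUB c : (forall a, c <= hi a) -> c <= minUB hi.
Proof.
move=> h; apply: (@le_inf_image _ _ setT) => //.
by case: (K) hK => // n _; exists ord0.
Qed.

Lemma maxLB_attained : exists a, lo a = maxLB lo.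
Proof.
have a0 : 'I_K by case: (K) hK => // n _; exact: ord0.
have [m _ mP] := @arg_maxP _ _ _ a0 xpredT lo isT.
exists m; apply/eqP; rewrite eq_le lo_le_maxLB/=.
apply: (@sup_image_le _ _ setT) => [|x _]; [by exists a0|exact: mP].
Qed.

Hypothesis sep : minUB hi < maxLB lo.

(** The arm with the largest lower bound is always a candidate; among the maximizers the smallest
    index satisfies the tie-breaking clause. *)
Lemma biased_armP : exists2 a, biased_arm lo hi = Some a &
  maxLB lo < hi a /\ forall b, maxLB lo < hi b ->
    min_biased_weight lo hi b <= min_biased_weight lo hi a.
Proof.
have [a0 la0] := maxLB_attained.
have Ea0 : maxLB lo < hi a0 by rewrite -la0.
have [m mE mP] := @arg_maxP _ _ _ a0 (fun a => maxLB lo < hi a)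
  (min_biased_weight lo hi) Ea0.
pose F a := (maxLB lo < hi a) &&
  (min_biased_weight lo hi a == min_biased_weight lo hi m).
have Fm : F m by rewrite /F mE eqxx.
have [n /andP[nE /eqP nm] nP] := @arg_minnP _ m F (fun a => a : nat) Fm.
rewrite /biased_arm; case: pickP => [a /andP[Ea /forallP aP]|/(_ n)].
  exists a => //; split => // b Eb.
  by have := aP b; rewrite Eb => /andP[].
move/negbT/negP; case; rewrite nE/=; apply/forallP => b; apply/implyP => Eb.
have bm := mP b Eb; rewrite /= in bm.
rewrite nm bm/=; apply/implyP => bn; rewrite lt_neqAle bm andbT; apply/negP => bme.
by have := nP b; rewrite /F Eb bme => /(_ isT); rewrite leqNgt bn.
Qed.

Lemma best_arm_biased_means a : maxLB lo < hi a ->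
  best_arm (biased_means lo hi a) = Some a.
Proof.
move=> ha; apply/best_arm_Some => b /negbTE ba; rewrite /biased_means ba eqxx.
by rewrite gt_max (le_lt_trans (lo_le_maxLB b))//= (lt_trans sep).
Qed.

End ExplorationBiased.

Lemma ebw_simplex (lo hi : 'I_K -> R) : simplex (exploration_biased_weights lo hi).2.
Proof.
rewrite /exploration_biased_weights; case: (leP (maxLB lo) (minUB hi)) => _ /=; first exact: simplex_uniform.
exact: opt_weights_simplex.
Qed.

(* The biased vector maximizing the upper bound of the arm with the largest lower
   bound is one of the candidates, and it has gaps at least the width of that
   confidence interval. *)
Lemma ebw_ge (lo hi : 'I_K -> R) k : 0 < k <= 1 -> (forall a, lo a < hi a) ->
  (forall a b, k * (hi a - hi b) <= hi a - lo a) ->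
  forall b, k ^+ 2 / (2 * K%:R) <= (exploration_biased_weights lo hi).2 b.
Proof.
move=> /andP[k0 k1] lohi hk b.
have K0 : 0 < K%:R :> R by rewrite ltr0n; exact: leq_trans hK.
rewrite /exploration_biased_weights; case: (leP (maxLB lo) (minUB hi)) => [_|sep] /=.
  rewrite ler_pdivrMr ?mulr_gt0// mulrCA mulVf ?gt_eqF// mulr1.
  by rewrite (@le_trans _ _ 1) ?expr_le1 ?(ltW k0)// ler1n.
have [a -> [Ea aP]] := biased_armP lohi.
have [a0 la0] := maxLB_attained lo.
have Ea0 : maxLB lo < hi a0 by rewrite -la0.
apply: (@le_trans _ _ (min_biased_weight lo hi a)); last first.
  by rewrite /min_biased_weight; exact: (@inf_image_le _ _ setT).
apply: le_trans (aP _ Ea0).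
apply: (@le_inf_image _ _ setT) => [|c _]; first by exists a.
have w0 : 0 < hi a0 - lo a0 by rewrite subr_gt0.
have D0 : 0 < hi a0 - minUB hi by rewrite subr_gt0 (lt_trans sep).
apply: le_trans (@opt_weights_ge _ a0 (hi a0 - lo a0) (hi a0 - minUB hi) _ w0 _ c).
- rewrite ler_pM2r ?invr_gt0 ?mulr_gt0// lerXn2r ?nnegrE ?(ltW k0) ?divr_ge0 ?(ltW w0) ?(ltW D0)//.
  rewrite ler_pdivlMr// mulrBr lerBlDl -lerBlDr -ler_pdivrMl//.
  apply: le_minUB => e; rewrite ler_pdivrMl// lerBlDl -lerBlDr -mulrBr.
  exact: hk.
- exact: best_arm_biased_means.
move=> e /negbTE ea; rewrite /biased_means eqxx ea !lerB//.
  by rewrite le_max lexx orbT.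
by rewrite ge_max la0 lo_le_maxLB ltW.
Qed.

(** When the box is this small, [a] is the only arm whose upper bound exceeds [maxLB], hence the
    only candidate. Its biased vector stays in the box because [minUB] is below every upper
    bound. *)
Lemma ebw_near mu a (lo hi : 'I_K -> R) e : (forall b, lo b < hi b) ->
  (forall b, mu b - e <= lo b) -> (forall b, hi b <= mu b + e) ->
  (forall b, b != a -> mu b + e < mu a - e) ->
  exists nu, [/\ (exploration_biased_weights lo hi).2 = opt_weights nu,
    best_arm nu = Some a & forall b, `|nu b - mu b| <= e].
Proof.
move=> lohi elo ehi gap.
have [c ca] := other_arm a.
have sep : minUB hi < maxLB lo.
  rewrite (le_lt_trans (minUB_le_hi hi c))// (le_lt_trans (ehi c))//.
  by rewrite (lt_le_trans (gap c ca))// (le_trans (elo a))// lo_le_maxLB.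
have [a' a'E [Ea' _]] := biased_armP lohi.
have aa : a' = a.
  apply/eqP/negPn/negP => /gap g.
  have := lo_le_maxLB lo a; have := elo a; have := ehi a'; lra.
exists (biased_means lo hi a); split.
- by rewrite /exploration_biased_weights leNgt sep a'E aa.
- by apply: best_arm_biased_means => //; rewrite -aa.
move=> b; rewrite /biased_means; have := elo b; have := ehi b; have := lohi b.
case: eqVneq => [->|ba] h1 h2 h3; first by rewrite ler_norml; lra.
have h4 := minUB_le_hi hi b.
rewrite ler_norml lerBrDr lerBlDr; apply/andP; split.
  by rewrite le_max; apply/orP; left; lra.
by rewrite ge_max; apply/andP; split; lra.
Qed.

Lemma min_gap nu a : best_arm nu = Some a ->
  exists2 l : R, 0 < l & forall b, b != a -> l <= nu a - nu b.
Proof.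
move=> /best_arm_Some nua; have [b1 b1a] := other_arm a.
have [m ma mP] := @arg_minP _ _ _ b1 (fun b => b != a) (fun b => nu a - nu b) b1a.
by exists (nu a - nu m); [rewrite subr_gt0 nua|].
Qed.

Lemma max_gain_gt0 nu a : best_arm nu = Some a -> 0 < gain nu a (opt_weights nu).
Proof.
move=> nua; have [l l0 lP] := min_gap nua.
have [_ /(_ _ simplex_uniform)] := opt_weights_max nua; apply: lt_le_trans.
apply: lt_le_trans (gain_uniform_ge l0 lP).
by rewrite divr_gt0 ?exprn_gt0// mulr_gt0// ltr0n (leq_trans _ hK).
Qed.

(** * Comparison of the maximal gain with the characteristic time *)

Section CharacteristicTime.
Variables (mu : 'I_K -> R) (a : 'I_K).
Hypotheses (mu01 : bandits mu) (mua : best_arm mu = Some a).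

Let cost v lam : R := \sum_x v x * ((mu x - lam x) ^+ 2 / 2).

Let cost_ge0 v lam : simplex v -> 0 <= cost v lam.
Proof.
move=> [v01 _]; apply: sumr_ge0 => x _; have /andP[v0 _] := v01 x.
by rewrite mulr_ge0// divr_ge0// sqr_ge0.
Qed.

(* Both arms are moved to their weighted mean, then the best arm other than [a]
   is lifted by [e] to make it the unique best one. *)
Lemma Alt_cost_le v b (e : R) : simplex v -> b != a -> 0 < e < 1 ->
  exists2 lam, Alt mu lam &
    cost v lam <= 2^-1 * (hprod (v a) (v b) * (mu a - mu b) ^+ 2) + 2 * e.
Proof.
move=> [v01 v1] ba /andP[e0 e1].
have v0 x : 0 <= v x by have /andP[] := v01 x.
have [m m01 mE] : exists2 m, 0 <= m <= 1 &
    v a * ((mu a - m) ^+ 2 / 2) + v b * ((mu b - m) ^+ 2 / 2) =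
    2^-1 * (hprod (v a) (v b) * (mu a - mu b) ^+ 2).
  have [|s0] := boolP (v a + v b == 0).
    rewrite paddr_eq0// => /andP[/eqP-> /eqP->]; exists 0; first by rewrite lexx ler01.
    by rewrite /hprod !mul0r mulr0 addr0.
  have s : 0 < v a + v b by rewrite lt_neqAle eq_sym s0 addr_ge0.
  exists ((v a * mu a + v b * mu b) / (v a + v b)); last by rewrite /hprod; field.
  have /andP[a0 a1] := mu01 a; have /andP[b0 b1] := mu01 b.
  rewrite divr_ge0 ?addr_ge0 ?mulr_ge0//= ler_pdivrMr// mul1r.
  by rewrite lerD// ler_piMr.
pose lam0 x := if (x == a) || (x == b) then m else mu x.
have lam001 x : 0 <= lam0 x <= 1 by rewrite /lam0; case: ifP => // _; exact: mu01.
have [c ca cP] := @arg_maxP _ _ _ b (fun x => x != a) lam0 ba.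
have lam0c x : lam0 x <= lam0 c.
  have [->|xa] := eqVneq x a; last exact: cP.
  by rewrite (le_trans _ (cP b ba))// /lam0 !eqxx orbT.
(* A convex combination, rather than an added [e], keeps the means in [0,1]. Arms [a] and [b] share
   a value in [lam0], so the maximum over the arms other than [a] is the overall maximum, and the
   mixture makes [c] strictly best. *)
pose lam x := (1 - e) * lam0 x + e * (x == c)%:R.
have lamc : best_arm lam = Some c.
  apply/best_arm_Some => x xc; rewrite /lam eqxx (negbTE xc).
  have : (1 - e) * lam0 x <= (1 - e) * lam0 c by rewrite ler_wpM2l//; lra.
  by rewrite mulr0 mulr1; lra.
exists lam.
  split; last by rewrite lamc mua; apply/eqP => -[] /eqP; rewrite (negbTE ca).
  split; last by rewrite lamc.
  move=> x; have /andP[h0 h1] := lam001 x.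
  have hc : 0 <= ((x == c)%:R : R) <= 1 by case: eqP => _; rewrite lexx ler01.
  rewrite /lam; have /andP[? ?] := hc; apply/andP; split.
    by rewrite addr_ge0// mulr_ge0//; lra.
  have : (1 - e) * lam0 x <= (1 - e) * 1 by rewrite ler_wpM2l//; lra.
  have : e * (x == c)%:R <= e * 1 by rewrite ler_wpM2l//; lra.
  lra.
have cost0 : cost v lam0 = 2^-1 * (hprod (v a) (v b) * (mu a - mu b) ^+ 2).
  rewrite /cost (bigD1 a)//= (bigD1 b)//= big1 ?addr0; last first.
    by move=> x /andP[xa xb]; rewrite /lam0 (negbTE xa) (negbTE xb) subrr expr0n mul0r mulr0.
  by rewrite /lam0 !eqxx orbT mE.
rewrite -cost0 -[2 * e]mul1r -[X in X * (2 * e)]v1 big_distrl/= /cost -big_split/=.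
apply: ler_sum => x _; rewrite -mulrDr ler_wpM2l//.
have /andP[h0 h1] := lam001 x; have /andP[g0 g1] := mu01 x.
have hc : 0 <= ((x == c)%:R : R) <= 1 by case: eqP => _; rewrite lexx ler01.
move: hc; rewrite /lam; set z := (x == c)%:R; move=> /andP[z0 z1].
have -> : (mu x - ((1 - e) * lam0 x + e * z)) ^+ 2 / 2 =
  (mu x - lam0 x) ^+ 2 / 2 + e * ((mu x - lam0 x) * (lam0 x - z)
    + e * ((lam0 x - z) ^+ 2 / 2)) by field.
rewrite lerD2l mulrC ler_wpM2r ?(ltW e0)//.
have p1 : (mu x - lam0 x) * (lam0 x - z) <= 1.
  rewrite (le_trans (ler_norm _))// normrM -[1]mulr1.
  by rewrite ler_pM// ler_norml; lra.
have p2 : (lam0 x - z) ^+ 2 / 2 <= 1.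
  rewrite ler_pdivrMr// mul1r (@le_trans _ _ 1)//; last by lra.
  by rewrite -real_normK ?num_real// expr_le1// ler_norml; lra.
have p3 : 0 <= (lam0 x - z) ^+ 2 / 2 by rewrite divr_ge0// sqr_ge0.
have : e * ((lam0 x - z) ^+ 2 / 2) <= 1 * 1 by rewrite ler_pM// ltW.
lra.
Qed.

(** One half of the closed formula suffices: the infimum over alternatives is at most the gain, for
    every [v]. Inverting the inequality requires a positive supremum, as the inverse of 0 is 0; the
    uniform weights provide it. *)
Lemma char_time_ge : (gain mu a (opt_weights mu))^-1 <= char_time mu.
Proof.
have [l l0 lP] := min_gap mua.
have K0 : 0 < K%:R :> R by rewrite ltr0n; exact: leq_trans hK.
have [b ba] := other_arm a.
pose V v := inf [set cost v lam | lam in Alt mu].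
have VE : char_time mu = (sup [set V v | v in simplex])^-1 by [].
have Vle v : simplex v -> V v <= gain mu a v.
  move=> sv; apply: le_gain => c ca; apply/ler_addgt0Pr => e e0.
  pose e' := Num.min (e / 2) 2^-1.
  have e'P : 0 < e' < 1.
    rewrite /e' lt_min gt_min; apply/andP; split; first by apply/andP; split; lra.
    by apply/orP; right; lra.
  have [lam Alam lamP] := Alt_cost_le sv ca e'P.
  rewrite (@le_trans _ _ (cost v lam))//.
    apply: ge_inf; last by exists lam.
    by exists 0 => _ [? _ <-]; exact: cost_ge0.
  rewrite (le_trans lamP)// lerD2l.
  have : e' <= e / 2 by rewrite /e' ge_min lexx.
  lra.
(* In an alternative with best arm [c], the displacements of [a] and [c] differ by at least the gap
   [l], and x^2 + y^2 >= (x - y)^2 / 2. *)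
have Vu : (l ^+ 2 / 4) / K%:R <= V (fun=> K%:R^-1).
  apply: lb_le_inf.
    have e0 : 0 < (2^-1 : R) < 1 by lra.
    have [lam Alam _] := Alt_cost_le simplex_uniform ba e0.
    by exists (cost (fun=> K%:R^-1) lam), lam.
  move=> _ [lam [[lam01 + ne] <-]]; case lamc : (best_arm lam) ne => [c|]// ne _.
  have ca : c != a by apply: contra_neq ne => ->; rewrite mua.
  have lac : lam a < lam c by move/best_arm_Some : lamc; apply; rewrite eq_sym.
  rewrite /cost (bigD1 a)//= (bigD1 c)//=.
  rewrite addrA (@le_trans _ _ (K%:R^-1 * ((mu a - lam a) ^+ 2 / 2) +
    K%:R^-1 * ((mu c - lam c) ^+ 2 / 2)))//; last first.
    rewrite lerDl sumr_ge0// => x _.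
    by rewrite mulr_ge0 ?invr_ge0 ?(ltW K0)// divr_ge0// sqr_ge0.
  rewrite -mulrDr mulrC ler_pM2l ?invr_gt0//.
  have hl := lP c ca.
  have : l ^+ 2 <= ((mu a - lam a) - (mu c - lam c)) ^+ 2.
    by rewrite lerXn2r ?nnegrE ?(ltW l0)//; lra.
  have := sqr_ge0 ((mu a - lam a) + (mu c - lam c)).
  by rewrite !expr2; nra.
have ubV : ubound [set V v | v in simplex] (gain mu a (opt_weights mu)).
  move=> _ [v sv <-]; rewrite (le_trans (Vle v sv))//.
  by have [_] := opt_weights_max mua; exact.
have Vu_sup : V (fun=> K%:R^-1) <= sup [set V v | v in simplex].
  apply: ub_le_sup; first by exists (gain mu a (opt_weights mu)).
  by exists (fun=> K%:R^-1) => //; exact: simplex_uniform.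
rewrite VE lef_pV2 ?posrE.
- by apply: ge_sup => //; exists (V (fun=> K%:R^-1)), (fun=> K%:R^-1) => //; exact: simplex_uniform.
- exact: max_gain_gt0.
apply: lt_le_trans Vu_sup; apply: lt_le_trans Vu.
by rewrite !divr_gt0// exprn_gt0.
Qed.

End CharacteristicTime.

End Weights.

(** * Concentration of the empirical means *)

Section IntegrationTools.
Local Open Scope ereal_scope.
Context d (T : measurableType d) (R : realType).

Section Density.
Variables (m nu : {measure set T -> \bar R}) (p : T -> R).
Hypotheses (mp : measurable_fun setT p) (p0 : forall x, (0 <= p x)%R).
Hypothesis nuE : forall V, measurable V -> nu V = \int[m]_(x in V) (p x)%:E.

Import HBNNSimple.

Let density_nnsfun (f : {nnsfun T >-> R}) :
  \int[nu]_x (f x)%:E = \int[m]_x ((f x)%:E * (p x)%:E).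
Proof.
under [LHS]eq_integral do rewrite fimfunE -fsumEFin//.
rewrite [LHS]ge0_integral_fsum//; last 2 first.
  - by move=> r; exact/measurable_EFinP/measurableT_comp.
  - by move=> n x _; rewrite EFinM nnfun_muleindic_ge0.
under [RHS]eq_integral.
  move=> x xD; rewrite fimfunE -fsumEFin// muleC ge0_mule_fsumr; last first.
    by move=> r; rewrite EFinM nnfun_muleindic_ge0.
  over.
rewrite [RHS]ge0_integral_fsum//; last 2 first.
  - move=> r; apply: emeasurable_funM; first exact/measurable_EFinP.
    by apply/measurable_EFinP; do 2 apply/measurableT_comp => //.
  - move=> n x _; rewrite mule_ge0//; first by rewrite lee_fin.
    by rewrite EFinM nnfun_muleindic_ge0.
apply: eq_fsbigr => r _; rewrite integralZl_indic_nnsfun// integral_indic// setIT.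
have mfr : measurable (f @^-1` [set r]) by exact: measurable_funPTI.
have [r0|r0] := leP 0%R r; last first.
  have fr : f @^-1` [set r] = set0.
    by apply/seteqP; split => // x /= fxr; move: r0; rewrite -fxr ltNge fun_ge0.
  rewrite fr measure0 mule0; apply/esym; apply: integral0_eq => x _.
  by rewrite indic0 mulr0 mule0.
rewrite nuE// [in LHS]integral_mkcond -ge0_integralZl//; last 2 first.
  - by apply/(measurable_restrictT _ _).1 => //; apply: measurable_funTS; exact/measurable_EFinP.
  - by move=> x _; apply: erestrict_ge0 => y _; rewrite lee_fin.
apply: eq_integral => x _; rewrite EFinM patchE indicE.
by case: ifPn => _; rewrite ?mule1 ?mule0// muleC.
Qed.

(** Simple functions, then monotone convergence. It is needed to integrate exponentials against the
    normal law. *)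
Lemma ge0_integral_density (f : T -> \bar R) : measurable_fun setT f ->
  (forall x, 0 <= f x) -> \int[nu]_x f x = \int[m]_x (f x * (p x)%:E).
Proof.
move=> mf f0; pose f_ := nnsfun_approx measurableT mf.
transitivity (lim (\int[nu]_x (f_ n x)%:E @[n --> \oo])).
  rewrite -monotone_convergence//=.
  - apply: eq_integral => ? /[!inE] xD; apply/esym/cvg_lim => //=.
    exact: cvg_nnsfun_approx.
  - by move=> n; exact/measurable_EFinP/measurable_funTS.
  - by move=> n ? _; rewrite lee_fin.
  - by move=> ? _ ? ? mn; rewrite lee_fin; exact/lefP/nd_nnsfun_approx.
under eq_fun do rewrite density_nnsfun.
rewrite -monotone_convergence//=.
- apply: eq_integral => x _; apply/cvg_lim => //=.
  apply: cvgeZr => //; exact: cvg_nnsfun_approx.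
- by move=> n; apply: emeasurable_funM; apply/measurable_EFinP => //; exact: measurable_funTS.
- by move=> n x _; rewrite mule_ge0// lee_fin.
- move=> x _ i j ij; rewrite lee_wpmul2r ?lee_fin//.
  exact/lefP/nd_nnsfun_approx.
Qed.

End Density.

Lemma ge0_integral_mrestr (m : {measure set T -> \bar R}) (E : set T)
    (mE : measurable E) (f : T -> \bar R) : measurable_fun setT f ->
  (forall x, 0 <= f x) -> \int[mrestr m mE]_x f x = \int[m]_(x in E) f x.
Proof.
move=> mf f0.
have nE : mrestr m mE (~` E) = 0 by rewrite /mrestr setICl measure0.
rewrite (@ge0_negligible_integral _ _ _ (mrestr m mE) setT (~` E))//; last first.
  exact: measurableC.
rewrite setTD setCK; apply: eq_measure_integral => A mA AE.
by rewrite /= /mrestr setIidl.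
Qed.

End IntegrationTools.

Section ConditionalIndependence.
Local Open Scope ereal_scope.
Context d d1 d2 (T : measurableType d) (T1 : measurableType d1)
  (T2 : measurableType d2) (R : realType).
Variables (P : probability T R) (nu : probability T2 R).
Variables (phi : T -> T1) (Y : T -> T2) (E : set T1).
Hypotheses (mphi : measurable_fun setT phi) (mY : measurable_fun setT Y).
Hypothesis mE : measurable E.
Hypothesis indep : forall H V, measurable H -> measurable V ->
  P (phi @^-1` (H `&` E) `&` Y @^-1` V) = P (phi @^-1` (H `&` E)) * nu V.

(* The law of (phi, Y) restricted to [E] is a product measure, hence Tonelli applies. *)
Lemma integral_conditional_law (f : T1 * T2 -> \bar R) :
  measurable_fun setT f -> (forall z, 0 <= f z) ->
  \int[P]_(w in phi @^-1` E) f (phi w, Y w) =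
  \int[P]_(w in phi @^-1` E) \int[nu]_y f (phi w, y).
Proof.
move=> mf f0.
have mEphi : measurable (phi @^-1` E) by rewrite -[X in measurable X]setTI; exact: mphi.
have mpair : measurable_fun setT (fun w => (phi w, Y w)) by exact/measurable_fun_pair.
pose Q_ : {measure set T1 -> \bar R} := pushforward P phi; pose Q := Q_ mphi.
have QE : Q E < +oo by rewrite /Q/= /pushforward (le_lt_trans (probability_le1 _ _))// ltry.
pose m1 : {finite_measure set T1 -> \bar R} := mfrestr mE QE.
pose L_ : {measure set (T1 * T2) -> \bar R} := pushforward P (fun w => (phi w, Y w)).
pose L := L_ mpair.
have mET : measurable (E `*` [set: T2]) by exact: measurableX.
pose m' : {measure set (T1 * T2) -> \bar R} := mrestr L mET.
have m1E X : measurable X -> (m1 \x nu) X = m' X.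
  move=> mX; apply: product_measure_unique => // H V mH mV.
  rewrite /m' /= /mrestr /m1 /= /mfrestr /mrestr /L /Q /= /pushforward.
  rewrite -indep//; congr (P _); apply/seteqP; split => w /=.
    by move=> [[? ?] [? _]].
  by move=> [[? ?] ?].
have int1 : \int[m1 \x nu]_z f z = \int[P]_(w in phi @^-1` E) f (phi w, Y w).
  rewrite (eq_measure_integral m'); last by move=> X mX _; exact: m1E.
  rewrite ge0_integral_mrestr// ge0_integral_pushforward//; last exact: measurable_funTS.
  by congr (integral _ _ _); apply/seteqP; split => w //= [].
rewrite -int1 fubini_tonelli1// /m1 ge0_integral_mrestr//.
- rewrite ge0_integral_pushforward//.
  + exact/measurable_funTS/measurable_fun_fubini_tonelli_F.
  + by move=> x _; exact: integral_ge0.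
- exact: measurable_fun_fubini_tonelli_F.
- by move=> x; exact: integral_ge0.
Qed.

End ConditionalIndependence.

Section GaussianTilting.
Local Open Scope ereal_scope.
Context {R : realType}.

(** Completing the square turns the tilted density into that of the normal law with mean m + l. *)
Lemma integral_normal_tilt (m l : R) :
  \int[normal_prob m 1]_y (expR (l * (y - m) - l ^+ 2 / 2))%:E = 1.
Proof.
have mg : measurable_fun setT (fun y : R => expR (l * (y - m) - l ^+ 2 / 2)).
  apply: measurableT_comp => //; apply: measurable_funB => //.
  by apply: measurable_funM => //; exact: measurable_funB.
rewrite (@ge0_integral_density _ _ _ (@lebesgue_measure R) _ (normal_pdf m 1))//=.
- rewrite -[RHS](integral_normal_pdf (m + l) 1).
  apply: eq_integral => y _; rewrite -EFinM; congr EFin.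
  rewrite !normal_pdfE ?oner_neq0// mulrCA; congr (_ * _)%R.
  rewrite /normal_fun -expRD; congr expR.
  by rewrite expr1n; field.
- exact: measurable_normal_pdf.
- exact: normal_pdf_ge0.
- exact/measurable_EFinP.
Qed.

End GaussianTilting.

(** * Likelihood ratios along the interaction and the deviation event *)

Section Interaction.
Context {R : realType} {K : nat} {d : measure_display} {Omega : measurableType d}.
Variables (P : probability Omega R) (mu : 'I_K -> R).
Variables (A : nat -> Omega -> 'I_K) (Y : nat -> Omega -> R).
Hypothesis hb : bandit_interaction A Y P mu.

Let gen t : set (set Omega) := [set E | exists s, (0 < s <= t)%N /\
  ((exists a, E = A s @^-1` [set a]) \/
   (exists2 V, measurable V & E = Y s @^-1` V))].

(** The space [Omega] equipped with the history as its sigma-algebra: adaptedness becomes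
    measurability of functions on [HT t]. *)
Let HT t := g_sigma_algebraType (gen t).

Lemma history_sub t : history A Y t `<=` measurable.
Proof.
elim/ltn_ind: t => t ih; apply: smallest_sub; first exact: sigma_algebra_measurable.
move=> E [[|s] [/andP[//= _ st]]] [[a ->]|[V mV ->]].
  by apply: (ih s) => //; exact: arm_from_past hb s a.
by rewrite -[X in measurable X]setTI; exact: (obs_measurable hb).
Qed.

Let measurable_arm_history t s a : (0 < s <= t.+1)%N ->
  measurable (A s @^-1` [set a] : set (HT t)).
Proof.
move=> /andP[s0]; rewrite leq_eqVlt => /predU1P[->|st]; first exact: arm_from_past hb t a.
by apply: sub_gen_smallest; exists s; rewrite s0; split => //; left; exists a.
Qed.

Let measurable_obs_history t s : (0 < s <= t)%N ->
  measurable_fun setT (Y s : HT t -> R).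
Proof.
move=> st _ V mV; rewrite setTI.
by apply: sub_gen_smallest; exists s; split => //; right; exists V.
Qed.

Let measurable_id_history t : measurable_fun setT (id : Omega -> HT t).
Proof. by move=> _ E mE; rewrite setTI; exact: (@history_sub t). Qed.

(* The log-likelihood ratio of the observations of [a] when its mean is shifted
   by [l]. *)
Definition log_likelihood (l : R) a t (w : Omega) : R :=
  \sum_(1 <= s < t.+1) (if A s w == a then l * (Y s w - mu a) - l ^+ 2 / 2 else 0).

Let measurable_log_likelihood_history l a t n : (n <= t)%N ->
  measurable_fun setT (log_likelihood l a n : HT t -> R).
Proof.
elim: n => [_|n ih nt].
  by rewrite /log_likelihood; under eq_fun do rewrite big_nil; exact: measurable_cst.
have -> : log_likelihood l a n.+1 = (fun w : HT t => log_likelihood l a n w +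
    (if A n.+1 w == a then l * (Y n.+1 w - mu a) - l ^+ 2 / 2 else 0)).
  by apply/funext => w; rewrite /log_likelihood big_nat_recr.
apply: (@measurable_funD _ (HT t)); first exact: (ih (ltnW nt)).
apply: (@measurable_fun_ifT _ _ (HT t)); last exact: measurable_cst.
  apply: (measurable_fun_bool true); rewrite setTI.
  rewrite [X in measurable X](_ : _ = A n.+1 @^-1` [set a]); last first.
    by apply/seteqP; split => w /= /eqP.
  by apply: measurable_arm_history; rewrite (leq_trans nt).
apply: measurable_funB; last exact: measurable_cst.
apply: measurable_funM; first exact: measurable_cst.
by apply: measurable_funB; [exact: measurable_obs_history|exact: measurable_cst].
Qed.

Lemma measurable_log_likelihood l a t : measurable_fun setT (log_likelihood l a t).
Proof.
move=> _ V mV; rewrite setTI; apply: (@history_sub t).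
by have := @measurable_log_likelihood_history l a t t (leqnn _) measurableT V mV; rewrite setTI.
Qed.

(** The martingale property: the ratio is unchanged where [a] is not chosen, and elsewhere is
    multiplied by a factor whose conditional mean is 1 by [integral_normal_tilt]. *)
Lemma integral_likelihood l a t :
  (\int[P]_w (expR (log_likelihood l a t w))%:E = 1)%E.
Proof.
elim: t => [|t ih].
  rewrite (eq_integral (cst 1%E)); last first.
    by move=> w _; rewrite /log_likelihood big_nil expR0.
  by rewrite integral_cst// mul1e; exact: probability_setT.
have mexp s : measurable_fun setT (fun w => (expR (log_likelihood l a s w))%:E).
  apply/measurable_EFinP; apply: measurableT_comp => //; exact: measurable_log_likelihood.
pose E := A t.+1 @^-1` [set a].
have mE : measurable E by apply: (@history_sub t); exact: arm_from_past hb t a.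
have split s : (\int[P]_w (expR (log_likelihood l a s w))%:E =
    \int[P]_(w in E) (expR (log_likelihood l a s w))%:E +
    \int[P]_(w in ~` E) (expR (log_likelihood l a s w))%:E)%E.
  rewrite -ge0_integral_setU ?setUv//.
  - exact: measurableC.
  - by apply/disj_setPS => w [].
have outside : (\int[P]_(w in ~` E) (expR (log_likelihood l a t.+1 w))%:E =
    \int[P]_(w in ~` E) (expR (log_likelihood l a t w))%:E)%E.
  apply: eq_integral => w; rewrite inE/= => /eqP/negbTE Aw.
  by rewrite /log_likelihood big_nat_recr//= Aw addr0.
rewrite split outside -[RHS]ih [RHS]split; apply: (f_equal (adde^~ _)).
pose f (z : HT t * R) : \bar R := (expR (log_likelihood l a t z.1) *
  expR (l * (z.2 - mu a) - l ^+ 2 / 2))%:E.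
transitivity (\int[P]_(w in E) f (w, Y t.+1 w))%E.
  apply: eq_integral => w; rewrite inE/= => Aw; rewrite /f/= -expRD.
  by rewrite /log_likelihood big_nat_recr//= Aw eqxx.
have mtilt : measurable_fun setT (fun y : R => expR (l * (y - mu a) - l ^+ 2 / 2)).
  apply: measurableT_comp => //; apply: measurable_funB => //.
  by apply: measurable_funM => //; exact: measurable_funB.
(* Here [phi] is the identity from [Omega] to [HT t], so the first argument of [f] carries the whole
   past. *)
rewrite [LHS](@integral_conditional_law _ _ _ Omega (HT t) _ _ P (normal_prob (mu a) 1)
  id (Y t.+1) E _ _ _ _ f).
- apply: eq_integral => w _; rewrite /f/=.
  under eq_integral do rewrite EFinM.
  rewrite ge0_integralZl_EFin ?expR_ge0//.
  + by rewrite integral_normal_tilt mule1.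
  + exact/measurable_EFinP.
- exact: measurable_id_history.
- exact: (obs_measurable hb).
- by apply: measurable_arm_history; rewrite ltnS leqnn.
- by move=> H V mH mV; exact: (obs_cond_law hb).
- apply/measurable_EFinP; apply: measurable_funM.
    apply: measurableT_comp => //; apply: measurableT_comp => //.
    exact: measurable_log_likelihood_history.
  by apply: (measurableT_comp mtilt); exact: measurable_snd.
- by move=> z; rewrite lee_fin mulr_ge0 ?expR_ge0.
Qed.

Lemma log_likelihood_tail l a t c :
  (P [set w | c <= log_likelihood l a t w]%R <= (expR (- c))%:E)%E.
Proof.
have mexp : measurable_fun setT (fun w => (expR (log_likelihood l a t w))%:E).
  apply/measurable_EFinP; apply: measurableT_comp => //; exact: measurable_log_likelihood.
set E := [set w | _].
have mE : measurable E.
  have := measurable_log_likelihood l a t.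
  move=> /(_ measurableT `[c, +oo[%classic (measurable_itv _)); rewrite setTI.
  by congr measurable; apply/seteqP; split => w; rewrite /= in_itv/= andbT.
rewrite expRN -[X in (_ <= X)%E]mule1 -(integral_likelihood l a t).
rewrite -lee_pdivrMl ?invr_gt0 ?expR_gt0// invrK.
apply: (@le_trans _ _ (\int[P]_(w in E) (expR (log_likelihood l a t w))%:E)%E).
  rewrite -integral_cst//; apply: ge0_le_integral => //=.
  - exact: measurable_funTS.
  - by move=> w Ew; rewrite lee_fin ler_expR.
exact: ge0_subset_integral.
Qed.

Lemma log_likelihoodE l a t w : (0 < pulls A a t w)%N ->
  log_likelihood l a t w = (pulls A a t w)%:R *
    (l * (emp_mean A Y a t w - mu a) - l ^+ 2 / 2).
Proof.
move=> N0.
have NE : (pulls A a t w)%:R = \sum_(1 <= s < t.+1 | A s w == a) 1 :> R.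
  by rewrite /pulls natr_sum [RHS]big_mkcond/=; apply: eq_bigr => s _; case: eqP.
have -> : (pulls A a t w)%:R * (l * (emp_mean A Y a t w - mu a) - l ^+ 2 / 2) =
    l * ((pulls A a t w)%:R * emp_mean A Y a t w) -
    (pulls A a t w)%:R * (l * mu a + l ^+ 2 / 2) by ring.
rewrite /emp_mean mulVKf ?pnatr_eq0 -?lt0n// NE.
rewrite mulr_suml mulr_sumr -sumrB /log_likelihood -big_mkcond/=.
by apply: eq_bigr => s _; ring.
Qed.

(** The best shift depends on the random number N of pulls, hence the union over round, N, arm and
    sign. With l = sqrt (8 ln T / N), a deviation D with N D^2 > 8 ln T, taken with its sign, yields
    a log-likelihood of at least N (l |D| - l^2 / 2) >= 4 ln T. *)
Definition deviation_event T : set Omega :=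
  [set w | exists z : 'I_T.+1 * 'I_T.+1 * 'I_K * bool,
    4 * ln T%:R <= log_likelihood
      ((-1) ^+ z.2 * Num.sqrt (8 * ln T%:R / z.1.1.2%:R)) z.1.2 z.1.1.1 w].

Lemma deviation_le T w t a : ~ deviation_event T w -> (t <= T)%N ->
  (pulls A a t w)%:R * (emp_mean A Y a t w - mu a) ^+ 2 <= 8 * ln T%:R.
Proof.
move=> good tT; set N := pulls A a t w; set D := emp_mean A Y a t w - mu a.
have [T0|T0] := posnP T.
  by rewrite /N /pulls; move: tT; rewrite T0 leqn0 => /eqP ->; rewrite big_geq// mul0r ln0 ?mulr0.
have lnT : 0 <= ln T%:R :> R by rewrite ln_ge0// ler1n.
have [N0|N0] := posnP N; first by rewrite N0 mul0r mulr_ge0.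
have NT : (N <= T)%N.
  rewrite (leq_trans _ tT)// /N /pulls.
  rewrite (@leq_trans (\sum_(1 <= s < t.+1) 1))//; last by rewrite sum_nat_const_nat muln1 subn1.
  by apply: leq_sum => s _; case: eqP.
rewrite leNgt; apply/negP => dev; apply: good.
pose l : R := Num.sqrt (8 * ln T%:R / N%:R).
have N0' : 0 < N%:R :> R by rewrite ltr0n.
have l2 : l ^+ 2 = 8 * ln T%:R / N%:R by rewrite sqr_sqrtr// divr_ge0// mulr_ge0.
exists (inord t, inord N, a, D < 0) => /=.
rewrite !inordK ?ltnS// -/l log_likelihoodE -/N -/D//.
rewrite exprMn sqrr_sign mul1r l2.
have lD : l <= `|D|.
  rewrite -ler_sqr ?nnegrE ?sqrtr_ge0// l2 real_normK ?num_real// ler_pdivrMr// [X in _ <= X]mulrC.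
  exact: ltW.
have -> : (-1) ^+ (D < 0)%R * l * D = l * `|D|.
  by rewrite mulrAC mulrC -normrEsign ?num_real.
have : l * l <= l * `|D| by rewrite ler_wpM2l// sqrtr_ge0.
rewrite -expr2 l2 => h.
have : N%:R * (8 * ln T%:R / N%:R) <= N%:R * (l * `|D|) by rewrite ler_wpM2l.
rewrite mulrBr [X in _ - X]mulrA [N%:R * (_ / _)]mulrC divfK ?gt_eqF//.
lra.
Qed.

Lemma measure_exists_le (I : finType) (F : I -> set Omega) :
  (forall i, measurable (F i)) ->
  measurable [set w | exists i, F i w] /\
  (P [set w | exists i, F i w] <= \sum_(i : I) P (F i))%E.
Proof.
move=> mF.
have step (s : seq I) : measurable [set w | exists2 i, i \in s & F i w] /\
    (P [set w | exists2 i, i \in s & F i w] <= \sum_(i <- s) P (F i))%E.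
  elim: s => [|i s [ms Ps]].
    rewrite (_ : [set w | _] = set0); last by apply/seteqP; split => w // [].
    by rewrite big_nil measure0.
  rewrite (_ : [set w | _] = F i `|` [set w | exists2 i, i \in s & F i w]); last first.
    apply/seteqP; split => w /=.
      by move=> [j]; rewrite inE => /predU1P[->|js Fj]; [left|right; exists j].
    by move=> [Fi|[j js Fj]]; [exists i; rewrite ?mem_head|exists j; rewrite // inE js orbT].
  split; first exact: measurableU.
  by rewrite big_cons (le_trans (measureU2 _ _ _))// leeD2l.
have -> : [set w | exists i, F i w] = [set w | exists2 i, i \in index_enum I & F i w].
  by apply/seteqP; split => w [i]; exists i => //; rewrite mem_index_enum.
exact: step.
Qed.

Lemma deviation_event_measurable T : measurable (deviation_event T).
Proof.
apply: (@measure_exists_le _ _ _).1 => z; rewrite -[X in measurable X]setTI.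
have := measurable_log_likelihood ((-1) ^+ z.2 * Num.sqrt (8 * ln T%:R / z.1.1.2%:R)) z.1.2 z.1.1.1.
move=> /(_ measurableT `[4 * ln T%:R, +oo[%classic (measurable_itv _)).
by congr measurable; apply/seteqP; split => w; rewrite /= in_itv/= andbT.
Qed.

(** There are 2 K (T + 1)^2 <= 8 K T^2 indices, each of probability at most T^-4. *)
Lemma deviation_event_tail T : (0 < T)%N ->
  (P (deviation_event T) <= (8 * K%:R / T%:R ^+ 2)%:E)%E.
Proof.
move=> T0; have T0' : 0 < T%:R :> R by rewrite ltr0n.
have mF := deviation_event_measurable T.
rewrite (le_trans (@measure_exists_le _ _ _).2)//.
  move=> z; rewrite -[X in measurable X]setTI.
  have := measurable_log_likelihood ((-1) ^+ z.2 * Num.sqrt (8 * ln T%:R / z.1.1.2%:R)) z.1.2 z.1.1.1.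
  move=> /(_ measurableT `[4 * ln T%:R, +oo[%classic (measurable_itv _)).
  by congr measurable; apply/seteqP; split => w; rewrite /= in_itv/= andbT.
apply: (@le_trans _ _ (\sum_(z : 'I_T.+1 * 'I_T.+1 * 'I_K * bool) (T%:R ^- 4)%:E)%E).
  apply: lee_sum => z _; rewrite (le_trans (log_likelihood_tail _ _ _ _))// lee_fin.
  by rewrite expRN expRM_natl lnK// posrE.
rewrite sumEFin lee_fin sumr_const card_prod card_bool !card_prod !card_ord -[X in X <= _]mulr_natr.
rewrite !natrM -natr1 [X in _ <= X]mulrC.
have T1 : 1 <= T%:R :> R by rewrite ler1n.
set x := T%:R in T0' T1 *; have K0 : 0 <= K%:R :> R by [].
have -> : x ^- 2 * (8 * K%:R) = x ^- 4 * (4 * x ^+ 2 * K%:R * 2) by field; rewrite gt_eqF.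
apply: ler_wpM2l; first by rewrite invr_ge0 exprn_ge0// ltW.
rewrite ler_wpM2r// ler_wpM2r//.
nra.
Qed.

(** 1 / n^2 is at most 2 / (n (n + 1)), which telescopes. *)
Lemma deviation_count_integral :
  (\int[P]_w (\sum_(T <oo) (\1_(deviation_event T.+1) w)%:E) <= (16 * K%:R)%:E)%E.
Proof.
rewrite integral_nneseries//; last first.
  by move=> n; apply/measurable_EFinP; apply: measurable_indic; exact: deviation_event_measurable.
apply: lime_le.
  by apply: is_cvg_nneseries => n _ _; apply: integral_ge0 => w _; rewrite lee_fin.
near=> n.
apply: (@le_trans _ _ (\sum_(0 <= T < n) (16 * K%:R * (T.+1%:R^-1 - T.+2%:R^-1))%:E)%E).
  apply: lee_sum => T _; rewrite integral_indic ?setIT//; last exact: deviation_event_measurable.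
  rewrite (le_trans (deviation_event_tail (ltn0Sn T)))// lee_fin.
  rewrite -[T.+2%:R]natr1; have T1 : 1 <= T.+1%:R :> R by rewrite ler1n.
  set x := T.+1%:R in T1 *.
  have -> : 16 * K%:R * (x^-1 - (x + 1)^-1) = 8 * K%:R * (2 / (x * (x + 1))).
    by field; apply/andP; split; rewrite gt_eqF//; lra.
  rewrite ler_wpM2l ?mulr_ge0// ler_pdivlMr ?mulr_gt0//; try lra.
  by rewrite mulrC ler_pdivrMr ?exprn_gt0//; nra.
rewrite sumEFin lee_fin -mulr_sumr (@telescope_sumr_eq _ _ _ (fun k => - k.+1%:R^-1))//.
  by rewrite ler_piMr ?mulr_ge0// invr1 opprK addrC lerBlDr lerDl invr_ge0.
by move=> k _; rewrite opprK addrC.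
Unshelve. all: by end_near.
Qed.

End Interaction.

(** * Trajectories outside the deviation event *)

Section Tracking.
Context {R : realType} {K : nat} {d : measure_display} {Omega : measurableType d}.
Hypothesis hK : (2 <= K)%N.
Variables (A : nat -> Omega -> 'I_K) (Y : nat -> Omega -> R) (gamma : R).
Hypothesis hebs : ebs_sampling A Y gamma.
Variable w : Omega.

Local Notation pulls a t := (pulls A a t w).
Local Notation weights s := (ebs_weights A Y gamma s w).
Local Notation gap t a := (tracking_gap A Y gamma t w a).

Lemma pulls_recr a t : pulls a t.+1 = (pulls a t + (A t.+1 w == a))%N.
Proof. by rewrite /Defs.pulls big_nat_recr. Qed.

Lemma sum_pulls t : (\sum_a pulls a t = t)%N.
Proof.
elim: t => [|t ih]; first by rewrite big1// => a _; rewrite /Defs.pulls big_geq.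
under eq_bigr do rewrite pulls_recr.
rewrite big_split/= ih (bigD1 (A t.+1 w))//= eqxx big1 ?addn0 ?addn1//.
by move=> a; rewrite eq_sym => /negbTE ->.
Qed.

Lemma pulls_le a t : (pulls a t <= t)%N.
Proof. by rewrite -[X in (_ <= X)%N](sum_pulls t) (bigD1 a)//= leq_addr. Qed.

Lemma pulls_homo a : {homo (fun t => pulls a t) : s t / (s <= t)%N}.
Proof. by apply: homo_leq => [//|s t u|t]; [exact: leq_trans|rewrite pulls_recr leq_addr]. Qed.

Lemma pulls_gt0 a t : (K <= t)%N -> (0 < pulls a t)%N.
Proof. by move=> /pulls_homo h; rewrite (leq_trans _ (h a))// (ebs_init hebs). Qed.

Lemma ebs_weights_simplex s : simplex (weights s).
Proof.
by rewrite /ebs_weights; case: ifP => _; [exact: simplex_uniform|exact: ebw_simplex].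
Qed.

Let weights_ge0 s a : 0 <= weights s a.
Proof. by have [/(_ a)/andP[]] := ebs_weights_simplex s. Qed.

Let gap_recr t a : gap t.+1 a = gap t a + ((A t.+1 w == a)%:R - weights t.+1 a).
Proof. by rewrite /tracking_gap pulls_recr big_nat_recr//= natrD; ring. Qed.

Let sum_gap t : \sum_a gap t a = 0.
Proof.
rewrite /tracking_gap sumrB -natr_sum sum_pulls exchange_big/=.
under eq_bigr do rewrite (ebs_weights_simplex _).2.
by rewrite sumr_const_nat subn1 subrr.
Qed.

(** The gaps sum to 0, so the smallest one, that of the arm pulled next, is nonpositive and rises by
    at most 1; the other gaps do not increase. *)
Lemma tracking_gap_le1 t a : (K <= t)%N -> gap t a <= 1.
Proof.
elim: t a => [|t ih] a; first by rewrite leqNgt (leq_trans _ hK).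
rewrite leq_eqVlt => /predU1P[<-|]; last rewrite ltnS => Kt.
  by rewrite /tracking_gap (ebs_init hebs) gerBl sumr_ge0.
rewrite gap_recr; have wa0 := weights_ge0 t.+1 a.
have [Aa|_] := eqVneq (A t.+1 w) a; last by have := ih a Kt; rewrite /=; lra.
suff : gap t a <= 0 by rewrite /=; lra.
rewrite leNgt; apply/negP => g0.
have : 0 < \sum_b gap t b.
  rewrite (lt_le_trans (_ : 0 < \sum_(b : 'I_K) gap t a))//.
    rewrite sumr_const card_ord pmulrn_lgt0 ?(leq_trans _ hK)//.
  by apply: ler_sum => b _; rewrite -Aa; exact: (ebs_tracking hebs).
by rewrite sum_gap ltxx.
Qed.

(** Since the other K - 1 gaps are at most 1 and all of them sum to 0, none falls below - (K -
    1). *)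
Lemma pulls_ge t a : (K <= t)%N ->
  \sum_(1 <= s < t.+1) weights s a - K%:R <= (pulls a t)%:R.
Proof.
move=> Kt; suff : - K%:R <= gap t a by rewrite /tracking_gap; lra.
have /eqP := sum_gap t; rewrite (bigD1 a)//= addr_eq0 => /eqP ->.
rewrite lerN2 (le_trans (ler_sum _ (fun b _ => tracking_gap_le1 b Kt)))//.
rewrite (eq_bigl (fun i => i \in predC1 a)); last by move=> i; rewrite inE.
by rewrite sumr_const cardC1 card_ord ler_nat leq_pred.
Qed.

Lemma pulls_ge_tail t0 t a : (K <= t)%N ->
  \sum_(t0.+1 <= s < t.+1) weights s a - K%:R <= (pulls a t)%:R.
Proof.
move=> Kt; apply: le_trans (pulls_ge a Kt); rewrite lerD2r.
have [tt0|tt0] := leqP t t0; first by rewrite big_geq// sumr_ge0.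
by rewrite [X in _ <= X](@big_cat_nat _ _ _ t0.+1)//=; [rewrite lerDr sumr_ge0|exact: ltnW].
Qed.

Lemma sum_inv_ge t1 t2 : (t1 <= t2)%N ->
  ln (t2.+1%:R / t1.+1%:R) <= \sum_(t1.+1 <= s < t2.+1) s%:R^-1 :> R.
Proof.
elim: t2 => [|t2 ih]; first by rewrite leqn0 => /eqP ->; rewrite divff// ln1 big_geq.
rewrite leq_eqVlt => /predU1P[->|]; first by rewrite divff// ln1 big_geq.
rewrite ltnS => t12; rewrite big_nat_recr//=.
have -> : t2.+2%:R / t1.+1%:R = t2.+1%:R / t1.+1%:R * (1 + t2.+1%:R^-1) :> R.
  by rewrite mulrAC mulrDr mulr1 divff// natr1.
rewrite lnM ?posrE ?divr_gt0 ?addr_gt0// lerD//; first exact: ih.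
by rewrite le_ln1Dx// (lt_trans (ltrN10 R))// invr_gt0.
Qed.

Lemma pulls_ge_ln c t1 t2 t a : 0 <= c -> (K <= t1 <= t2)%N -> (t2 <= t)%N ->
  (forall s, (t1 < s <= t2)%N -> c / s%:R <= weights s a) ->
  c * ln (t2.+1%:R / t1.+1%:R) - K%:R <= (pulls a t)%:R.
Proof.
move=> c0 /andP[Kt1 t12] t2t hc.
apply: (@le_trans _ _ (pulls a t2)%:R); last by rewrite ler_nat; exact: pulls_homo.
apply: le_trans (@pulls_ge_tail t1 t2 a (leq_trans Kt1 t12)); rewrite lerD2r.
rewrite (le_trans (ler_wpM2l c0 (sum_inv_ge t12)))// mulr_sumr.
by rewrite !big_nat; apply: ler_sum => s; exact: hc.
Qed.

End Tracking.

(** * Upper and lower bounds on the confidence radii *)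

Section ConfidenceWidth.
Context {R : realType}.
Implicit Types (g x y : R) (n s : nat).

Lemma expR1_le4 : expR 1 <= 4 :> R.
Proof.
have h : 2^-1 <= expR (- 2^-1) :> R by have := expR_ge1Dx (- 2^-1 : R); lra.
have -> : 1 = 2^-1 + 2^-1 :> R by lra.
rewrite expRD; have : expR (2^-1) <= 2 :> R.
  by rewrite -[expR _]invrK -expRN -[leRHS]invrK lef_pV2 ?posrE ?expR_gt0.
by have := expR_gt0 (2^-1 : R); nra.
Qed.

Lemma ln_ge1 x : 4 <= x -> 1 <= ln x.
Proof.
move=> x4; rewrite -[1]expRK ler_ln ?posrE ?expR_gt0//; last by lra.
exact: le_trans expR1_le4 _.
Qed.

Lemma ln_le x : 0 < x -> ln x <= x - 1.
Proof. by move=> x0; have := @le_ln1Dx R (x - 1); rewrite subrKC; apply; lra. Qed.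

Let ln_arg_ge4 g n : 0 < g < 1 -> (0 < n)%N -> 4 <= 4 * n%:R / g.
Proof.
move=> /andP[g0 g1] n0; rewrite ler_pdivlMr// ler_pM2l//.
by rewrite (le_trans (ltW g1))// ler1n.
Qed.

Lemma conf_width_gt0 g n : 0 < g < 1 -> (0 < n)%N -> 0 < conf_width g n.
Proof.
move=> g01 n0; rewrite /conf_width mulr_gt0// sqrtr_gt0 divr_gt0 ?ltr0n//.
by rewrite (lt_le_trans ltr01)// ln_ge1// ln_arg_ge4.
Qed.

(* ln (c x) / x is nonincreasing where c x >= e. *)
Lemma conf_width_ge g n s : 0 < g < 1 -> (0 < n <= s)%N ->
  2 * Num.sqrt (ln s%:R / s%:R) <= conf_width g n.
Proof.
move=> /[dup] g01 /andP[g0 g1] /andP[n0 ns].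
rewrite /conf_width ler_wpM2l// ler_wsqrtr//.
have N0 : 0 < n%:R :> R by rewrite ltr0n.
have NS : n%:R <= s%:R :> R by rewrite ler_nat.
have S0 : 0 < s%:R :> R by exact: lt_le_trans NS.
set c := 4 * n%:R / g; have c4 : 4 <= c by exact: ln_arg_ge4.
have c1 := ln_ge1 c4; have c0 : 0 < c by lra.
have sn0 : 0 < s%:R / n%:R :> R by rewrite divr_gt0.
have sc : ln s%:R <= ln c + (s%:R / n%:R - 1).
  rewrite (@le_trans _ _ (ln (c * (s%:R / n%:R))))//.
    rewrite ler_ln ?posrE//; last exact: mulr_gt0.
    rewrite /c mulrA ler_pdivlMr// mulrAC ler_pdivlMr//.
    have : s%:R * n%:R * g <= s%:R * n%:R * 1 by rewrite ler_wpM2l ?mulr_ge0// ltW.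
    have : 0 < s%:R * n%:R :> R by rewrite mulr_gt0.
    lra.
  by rewrite lnM ?posrE// lerD2l ln_le.
rewrite ler_pdivrMr// mulrAC ler_pdivlMr//.
have : ln s%:R * n%:R <= (ln c + (s%:R / n%:R - 1)) * n%:R by rewrite ler_wpM2r// ltW.
have -> : (ln c + (s%:R / n%:R - 1)) * n%:R = ln c * n%:R + s%:R - n%:R.
  by field; rewrite gt_eqF.
have : 0 <= (ln c - 1) * (s%:R - n%:R) by rewrite mulr_ge0//; lra.
lra.
Qed.

(** The crude ln y <= 2 sqrt y at y = 4 n / g bounds the squared width by 16 / sqrt (g n), whence
    the fourth power of [x] and 256 = 16^2. *)
Lemma conf_width_le g x n : 0 < g -> 0 < x -> 256 / (g * x ^+ 4) <= n%:R ->
  conf_width g n <= x.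
Proof.
move=> g0 x0 hn.
have n0 : 0 < n%:R :> R by apply: lt_le_trans hn; apply: divr_gt0; [rewrite ltr0n|rewrite mulr_gt0 ?exprn_gt0].
rewrite /conf_width; set y := 4 * n%:R / g.
have y0 : 0 < y by rewrite divr_gt0// mulr_gt0.
pose s := Num.sqrt y.
have s0 : 0 < s by rewrite sqrtr_gt0.
have s2 : s ^+ 2 = y by rewrite sqr_sqrtr// ltW.
have xg : 0 < g * x ^+ 2 by rewrite mulr_gt0// exprn_gt0.
have sx : 32 <= s * (g * x ^+ 2).
  rewrite -ler_pdivrMr// -ler_sqr ?nnegrE ?divr_ge0 ?(ltW xg) ?(ltW s0)// s2 /y.
  rewrite ler_pdivlMr// -ler_pdivrMl//.
  apply: le_trans hn; rewrite le_eqVlt; apply/orP; left; apply/eqP.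
  by field; rewrite !gt_eqF.
have lny : ln y <= 2 * s.
  rewrite -s2 -[s ^+ 2]/(s * s) lnM ?posrE//; have := ln_le s0; lra.
have hx : ln y / n%:R <= (x / 2) ^+ 2.
  rewrite ler_pdivrMr// (le_trans lny)//.
  have -> : n%:R = g * s ^+ 2 / 4 by rewrite s2 /y; field; rewrite gt_eqF.
  have -> : (x / 2) ^+ 2 * (g * s ^+ 2 / 4) = s * (s * (g * x ^+ 2)) / 16 by field.
  have : s * 32 <= s * (s * (g * x ^+ 2)) by rewrite ler_wpM2l// ltW.
  lra.
suff : Num.sqrt (ln y / n%:R) <= x / 2 by lra.
rewrite -[leRHS]ger0_norm; last by rewrite divr_ge0// ltW.
by rewrite -sqrtr_sqr ler_wsqrtr.
Qed.

End ConfidenceWidth.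

(** * Lower bounds on the numbers of pulls *)

Section GoodTrajectory.
Context {R : realType} {K : nat} {d : measure_display} {Omega : measurableType d}.
Hypothesis hK : (2 <= K)%N.
Variables (gamma : R) (mu : 'I_K -> R).
Hypotheses (hgamma : 0 < gamma < 1) (hmu : bandits mu).
Variables (A : nat -> Omega -> 'I_K) (Y : nat -> Omega -> R).
Hypothesis hebs : ebs_sampling A Y gamma.
Variables (w : Omega) (T : nat).
Hypothesis good : forall t a, (t <= T)%N ->
  (pulls A a t w)%:R * (emp_mean A Y a t w - mu a) ^+ 2 <= 8 * ln T%:R.

Lemma conf_level_itv : 0 < gamma / K%:R < 1.
Proof.
have /andP[g0 g1] := hgamma.
have K1 : 1 < K%:R :> R by rewrite ltr1n.
rewrite divr_gt0//=; last lra.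
by rewrite ltr_pdivrMr; lra.
Qed.

Lemma emp_mean_near (m : R) t a : 0 < m -> (t <= T)%N -> m <= (pulls A a t w)%:R ->
  `|emp_mean A Y a t w - mu a| <= Num.sqrt (8 * ln T%:R / m).
Proof.
move=> m0 tT mN; rewrite -sqrtr_sqr ler_wsqrtr// ler_pdivlMr// mulrC.
by apply: le_trans (good a tT); rewrite ler_wpM2r// sqr_ge0.
Qed.

Lemma conf_interval_nonempty a t : (K <= t)%N -> 0 < conf_radius A gamma a t w.
Proof.
by move=> Kt; rewrite /conf_radius conf_width_gt0// ?conf_level_itv// (pulls_gt0 hebs).
Qed.

(** An instance of [ebw_ge] with k = x / (3 + 2 z): x = 2 sqrt (ln s / s) is below every radius, and
    z bounds the errors of the estimates. As the means lie in [0,1], two upper bounds differ by at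
    most 1 + 2 z + C, with C the radius of the larger. *)
Lemma ebs_weights_ge (m : R) s a : 0 < m -> (K <= s <= T)%N ->
  (forall b, m <= (pulls A b s w)%:R) ->
  2 * ln s%:R / (K%:R * s%:R * (3 + 2 * Num.sqrt (8 * ln T%:R / m)) ^+ 2)
    <= ebs_weights A Y gamma s w a.
Proof.
move=> m0 /andP[Ks sT] hm; rewrite /ebs_weights ltnNge Ks/=.
set z := Num.sqrt _; have z0 : 0 <= z by exact: sqrtr_ge0.
have s0 : 0 < s%:R :> R by rewrite ltr0n (leq_trans _ Ks)// (leq_trans _ hK).
have K0 : 0 < K%:R :> R by rewrite ltr0n (leq_trans _ hK).
have s1 : 1 < s%:R :> R by rewrite ltr1n (leq_trans _ Ks).
have lns : 0 < ln s%:R :> R by rewrite ln_gt0.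
pose x : R := 2 * Num.sqrt (ln s%:R / s%:R).
have x0 : 0 < x by rewrite mulr_gt0// sqrtr_gt0 divr_gt0.
have x2 : x ^+ 2 = 4 * ln s%:R / s%:R.
  by rewrite exprMn sqr_sqrtr ?divr_ge0 ?(ltW lns)//; ring.
have x_le2 : x <= 2.
  suff : Num.sqrt (ln s%:R / s%:R) <= 1 :> R by rewrite /x; lra.
  rewrite -[leRHS]sqrtr1 ler_wsqrtr//.
  by rewrite ler_pdivrMr// mul1r; have := ln_le s0; lra.
pose k := x / (3 + 2 * z).
have k01 : 0 < k <= 1.
  by rewrite divr_gt0//=; [rewrite ler_pdivrMr; lra|lra].
have -> : 2 * ln s%:R / (K%:R * s%:R * (3 + 2 * z) ^+ 2) = k ^+ 2 / (2 * K%:R).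
  by rewrite /k expr_div_n x2; field; rewrite !gt_eqF//; lra.
have rad b := conf_interval_nonempty b Ks.
apply: ebw_ge => // [b|b c]; first by have := rad b; lra.
have xb : x <= conf_radius A gamma b s w.
  by apply: conf_width_ge; rewrite ?conf_level_itv// (pulls_gt0 hebs)//= pulls_le.
have rc := rad c; have rb := rad b; set C := conf_radius A gamma b s w in xb rb *.
have := emp_mean_near m0 sT (hm b); have := emp_mean_near m0 sT (hm c).
rewrite -/z !ler_norml => /andP[c1 c2] /andP[b1 b2].
have /andP[mb0 mb1] := hmu b; have /andP[mc0 mc1] := hmu c.
have /andP[k0 _] := k01.
rewrite (@le_trans _ _ (k * (1 + 2 * z + C)))//; first by rewrite ler_wpM2l ?(ltW k0)//; lra.
rewrite (_ : _ + C - _ = 2 * C); last by ring.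
rewrite /k mulrAC ler_pdivrMr; last by lra.
(* If C <= 2, the spread is at most 3 + 2 z and x <= C. A larger radius also enlarges the spread,
   and then x <= 2 is used instead. *)
have [C2|C2] := leP C 2.
  have : x * (1 + 2 * z + C) <= C * (3 + 2 * z) by apply: ler_pM; lra.
  have : 0 <= C * (3 + 2 * z) by rewrite mulr_ge0; lra.
  lra.
have : x * (1 + 2 * z + C) <= 2 * (1 + 2 * z + C) by rewrite ler_wpM2r//; lra.
have : 0 <= (C - 2) * (1 + 2 * z) by rewrite mulr_ge0//; lra.
have : 0 <= C * z by rewrite mulr_ge0//; lra.
rewrite !mulrDr !mulrDl; lra.
Qed.

(** The ratio is at least sqrt x. With x = q and y a power of q, it bounds the harmonic sum over one
    scale by half of ln q. *)
Lemma ln_ratio_ge (x y : R) : 1 <= x -> 1 <= y ->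
  ln x / 2 <= ln ((x * y + 1) / (y + 1)).
Proof.
move=> x1 y1; have y0 : 0 < y + 1 by lra.
have xy : 1 <= x * y by rewrite -[1]mulr1 ler_pM.
have r0 : 0 < (x * y + 1) / (y + 1) by rewrite divr_gt0//; lra.
rewrite ler_pdivrMr// mulr_natr -lnXn// ler_ln ?posrE ?exprn_gt0//; last lra.
rewrite expr_div_n ler_pdivlMr ?exprn_gt0//.
rewrite -subr_ge0.
have -> : (x * y + 1) ^+ 2 - x * (y + 1) ^+ 2 = (x - 1) * (x * y * y - 1) by ring.
by rewrite mulr_ge0//; [lra|rewrite subr_ge0 -[1]mulr1 ler_pM].
Qed.

(* Bootstrap along the scales q, q^2, q^3 with q ~ T^(1/4): a first crude bound on
   the weights gives c log T pulls of each arm, hence bounded deviations and weights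
   of order log T / s, hence c (log T)^2 pulls and vanishing deviations. *)
Section Bootstrap.
Variable q : nat.
Hypotheses (Kq : (K <= q)%N) (qT : (q ^ 4 <= T)%N) (Tq : (T < q.+1 ^ 4)%N).

Local Notation L := (@ln R T%:R).

(* 328 = 4 * 82 where (3 + 2 sqrt (8 L))^2 <= 82 L, and 256 / growth1 = 8 L / m with
   m = growth1 L / 32 the number of pulls after the first stage. *)
Definition growth1 : R := (328 * K%:R)^-1.
Definition growth2 : R :=
  (4 * K%:R * (3 + 2 * Num.sqrt (256 / growth1)) ^+ 2)^-1.

Hypotheses (L1 : 1 <= L) (Lg1 : 32 * K%:R / growth1 <= L)
  (Lg2 : 32 * K%:R / growth2 <= L).

Let K0 : 0 < K%:R :> R. Proof. by rewrite ltr0n (leq_trans _ hK). Qed.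

Let q1 : (1 < q)%N. Proof. exact: leq_trans Kq. Qed.

Let qR : 1 <= q%:R :> R. Proof. by rewrite ler1n ltnW. Qed.

Let spread_gt0 (x : R) : 0 < (3 + 2 * Num.sqrt x) ^+ 2.
Proof. by have := sqrtr_ge0 x; rewrite -[ltLHS](expr0n R 2) ltrXn2r//= => ?; lra. Qed.

Let spread_le (z l : R) : 1 <= l -> z ^+ 2 = 8 * l -> (3 + 2 * z) ^+ 2 <= 82 * l.
Proof.
move=> l1 z2; have -> : (3 + 2 * z) ^+ 2 = 9 + 12 * z + 4 * z ^+ 2 by ring.
have := sqr_ge0 (z - 3).
have -> : (z - 3) ^+ 2 = z ^+ 2 - 6 * z + 9 by ring.
by rewrite z2; lra.
Qed.

Lemma growth1_gt0 : 0 < growth1.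
Proof. by rewrite invr_gt0; apply: mulr_gt0; rewrite ltr0n// (leq_trans _ hK). Qed.

Lemma growth2_gt0 : 0 < growth2.
Proof.
rewrite invr_gt0; apply: mulr_gt0; first by rewrite mulr_gt0.
exact: spread_gt0.
Qed.

(** T < (q + 1)^4 <= q^8, because q + 1 <= q^2 for q >= 2. *)
Let lnq : L <= 8 * ln q%:R.
Proof.
rewrite mulr_natl -lnXn ?(lt_le_trans ltr01)// ler_ln ?posrE ?exprn_gt0 ?ltr0n//.
- rewrite -natrX ler_nat (leq_trans (ltnW Tq))//.
  have -> : (q ^ 8 = (q ^ 2) ^ 4)%N by rewrite -expnM.
  by rewrite leq_exp2r// expnS expn1 (leq_trans (_ : q.+1 <= q * 2)%N)// ?leq_mul//
    muln2 -addnn -addn1 leq_add2l ltnW.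
- by rewrite (leq_trans _ qT)// expn_gt0 ltnW.
- exact: ltnW.
Qed.

Let q_le_pow n s : (q ^ n.+1 < s)%N -> (q <= s)%N.
Proof.
by move=> /ltnW; apply: leq_trans; rewrite expnS leq_pmulr// expn_gt0 ltnW.
Qed.

Let pow_le_T n : (n <= 4)%N -> (q ^ n <= T)%N.
Proof. by move=> n4; rewrite (leq_trans _ qT)// leq_pexp2l// ltnW. Qed.

Let L0 : 0 < L. Proof. exact: lt_le_trans L1. Qed.

Let lns s : (q <= s)%N -> L / 8 <= ln s%:R.
Proof.
move=> qs; rewrite ler_pdivrMr// mulrC (le_trans lnq)// ler_pM2l//.
by rewrite ler_ln ?posrE ?ltr0n ?ler_nat// ?(leq_trans _ qs)// ltnW.
Qed.

(** Weights of at least c / s over one scale sum to c ln q / 2 >= c L / 16; half of this absorbs the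
    tracking loss K. *)
Let scale_step n t a (c : R) : (n <= 2)%N -> 0 <= c -> (q ^ n.+2 <= t)%N ->
  32 * K%:R <= c * L ->
  (forall s, (q ^ n.+1 < s <= q ^ n.+2)%N -> c / s%:R <= ebs_weights A Y gamma s w a) ->
  c * L / 32 <= (pulls A a t w)%:R.
Proof.
move=> n2 c0 nt cL hs.
have Kqn : (K <= q ^ n.+1 <= q ^ n.+2)%N.
  rewrite leq_pexp2l// ?(ltnW q1)// andbT (leq_trans Kq)//.
  by rewrite expnS leq_pmulr// expn_gt0 ltnW.
apply: le_trans (pulls_ge_ln hK hebs c0 Kqn nt hs).
have y1 : 1 <= (q ^ n.+1)%:R :> R by rewrite ler1n expn_gt0 ltnW.
have := ln_ratio_ge qR y1; rewrite -natrM -expnS !natr1 => hln.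
have := ler_wpM2l c0 hln; have := ler_wpM2l c0 lnq; lra.
Qed.

(** With a single pull of each arm guaranteed, the squared spread is of order L and cancels the
    factor ln s, leaving weights of order 1 / s. *)
Let stage1 t a : (q ^ 2 <= t)%N -> growth1 * L / 32 <= (pulls A a t w)%:R.
Proof.
move=> qt; apply: (@scale_step 0) => //; first exact/ltW/growth1_gt0.
  by rewrite [leRHS]mulrC -ler_pdivrMr ?growth1_gt0.
move=> s; rewrite expn1 => /andP[qs sq2].
have KsT : (K <= s <= T)%N.
  by rewrite (leq_trans Kq (ltnW qs)) (leq_trans sq2)// pow_le_T.
have m1 b : 1 <= (pulls A b s w)%:R :> R.
  by rewrite ler1n (pulls_gt0 hebs)//; case/andP: KsT.
apply: le_trans (ebs_weights_ge a ltr01 KsT m1).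
have s0 : 0 < s%:R :> R by rewrite ltr0n (leq_trans _ qs).
set z := Num.sqrt _; have z0 : 0 <= z by exact: sqrtr_ge0.
have z2 : z ^+ 2 = 8 * L by rewrite sqr_sqrtr divr1// mulr_ge0// ltW.
have hE : (3 + 2 * z) ^+ 2 <= 82 * L by exact: spread_le.
have E0 : 0 < (3 + 2 * z) ^+ 2 by rewrite exprn_gt0//; lra.
rewrite ler_pdivlMr; last by apply: mulr_gt0 => //; exact: mulr_gt0.
have := lns (ltnW qs); rewrite /growth1.
have -> : (328 * K%:R)^-1 / s%:R * (K%:R * s%:R * (3 + 2 * z) ^+ 2) =
    (3 + 2 * z) ^+ 2 / 328.
  by field; rewrite ?gt_eqF//; lra.
lra.
Qed.

Lemma pulls_ge_sqr_ln t a : (q ^ 3 <= t)%N -> growth2 * L ^+ 2 / 32 <= (pulls A a t w)%:R.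
Proof.
move=> qt; rewrite expr2 mulrA.
have g20 := growth2_gt0; have g10 := growth1_gt0.
apply: (@scale_step 1) => //; first by rewrite mulr_ge0 ?(ltW g20)// ltW.
  have : 32 * K%:R <= growth2 * L by rewrite [leRHS]mulrC -ler_pdivrMr.
  have : growth2 * L * 1 <= growth2 * L * L by rewrite ler_wpM2l// mulr_ge0// ltW.
  lra.
move=> s /andP[qs sq3].
have KsT : (K <= s <= T)%N.
  by rewrite (leq_trans Kq (q_le_pow qs)) (leq_trans sq3)// pow_le_T.
have m0 : 0 < growth1 * L / 32 by rewrite divr_gt0// mulr_gt0.
have hm b : growth1 * L / 32 <= (pulls A b s w)%:R by apply: stage1; exact: ltnW.
apply: le_trans (ebs_weights_ge a m0 KsT hm).
have s0 : 0 < s%:R :> R by rewrite ltr0n (leq_trans _ qs).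
have -> : 8 * L / (growth1 * L / 32) = 256 / growth1.
  by field; rewrite ?gt_eqF.
rewrite /growth2; set E := (3 + _) ^+ 2.
have E0 : 0 < E by exact: spread_gt0.
have -> : (4 * K%:R * E)^-1 * L / s%:R = 2 * (L / 8) / (K%:R * s%:R * E).
  by field; rewrite ?gt_eqF.
have D0 : 0 < K%:R * s%:R * E by apply: mulr_gt0 => //; exact: mulr_gt0.
clearbody E; rewrite ler_pM2r ?invr_gt0// ler_pM2l//.
exact/lns/(q_le_pow qs).
Qed.

End Bootstrap.

End GoodTrajectory.

(** * Uniform consistency and linear growth of the stopping statistic *)

Section Asymptotics.
Context {R : realType} {K : nat} {d : measure_display} {Omega : measurableType d}.
Hypothesis hK : (2 <= K)%N.
Variables (gamma : R) (mu : 'I_K -> R) (best : 'I_K).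
Hypotheses (hgamma : 0 < gamma < 1) (hmu : bandits mu) (hbest : best_arm mu = Some best).
Implicit Types (A : nat -> Omega -> 'I_K) (Y : nat -> Omega -> R) (w : Omega).

Definition good_trajectory A Y w T := forall t a, (t <= T)%N ->
  (pulls A a t w)%:R * (emp_mean A Y a t w - mu a) ^+ 2 <= 8 * ln T%:R.

Let K0 : 0 < K%:R :> R. Proof. by rewrite ltr0n (leq_trans _ hK). Qed.

Lemma ln_large (M : R) : exists n : nat, forall T, (n <= T)%N -> M <= ln T%:R.
Proof.
exists (Num.truncn (expR M)).+1 => T nT.
rewrite -[M]expRK ler_ln ?posrE ?expR_gt0//; last by rewrite ltr0n (leq_trans _ nT).
by rewrite (le_trans (ltW (truncnS_gt _)))// ler_nat.
Qed.

Lemma fourth_root_large (Q T : nat) : (Q ^ 4 <= T)%N ->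
  exists q, [/\ (Q <= q)%N, (q ^ 4 <= T)%N & (T < q.+1 ^ 4)%N].
Proof.
move=> QT; pose p q := (q ^ 4 <= T)%N.
have ub q : p q -> (q <= T)%N.
  by apply: leq_trans; case: q => // q; rewrite expnS leq_pmulr// expn_gt0.
have [q qT qmax] := ex_maxnP (ex_intro p Q QT) ub.
exists q; split => //; first exact: qmax.
by rewrite ltnNge; apply/negP => /qmax; rewrite ltnn.
Qed.

(** The discarded rounds stop at q^3, a fraction of at most 1 / q of T. After them each arm has
    pulls of order (ln T)^2, which beat the factor 8 ln T allowed by a good trajectory. *)
Lemma uniform_consistency (x : R) : 0 < x -> exists T0, forall T, (T0 <= T)%N ->
  exists t0, [/\ (K <= t0 <= T)%N, t0%:R <= x * T%:R &
    forall A Y w, ebs_sampling A Y gamma -> good_trajectory A Y w T ->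
    forall t a, (t0 <= t <= T)%N ->
      `|emp_mean A Y a t w - mu a| <= x /\ conf_radius A gamma a t w <= x].
Proof.
move=> x0; have /andP[g0 g1] := conf_level_itv hK hgamma.
have g10 : 0 < growth1 (R := R) (K := K) by exact: growth1_gt0.
have g20 : 0 < growth2 (R := R) (K := K) by exact: growth2_gt0.
set c1 := growth1 in g10; set c2 := growth2 in g20.
(* [y1] and [y2] start the bootstrap, [y3] brings the deviations below [x], and [y4] ensures the
   [y5] pulls that bring the radii below [x]. *)
pose y1 : R := 32 * K%:R / c1; pose y2 : R := 32 * K%:R / c2.
pose y3 : R := 256 / (c2 * x ^+ 2).
pose y5 : R := 256 / (gamma / K%:R * x ^+ 4); pose y4 : R := y5 * 32 / c2.
have [n nP] := ln_large (1 + y1 + y2 + y3 + y4).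
pose Q := maxn K (Num.truncn x^-1).+1.
exists (maxn n (Q ^ 4)) => T; rewrite geq_max => /andP[/nP LT /fourth_root_large].
move=> [q [Qq qT Tq]].
have Kq : (K <= q)%N by apply: leq_trans Qq; rewrite leq_maxl.
have q0 : (0 < q)%N by rewrite (leq_trans _ Kq)// (leq_trans _ hK).
have xq : x^-1 <= q%:R.
  rewrite (le_trans (ltW (truncnS_gt _)))// ler_nat.
  by apply: leq_trans Qq; rewrite leq_maxr.
have h1 : 0 <= y1 by rewrite divr_ge0 ?mulr_ge0 ?ltW.
have h2 : 0 <= y2 by rewrite divr_ge0 ?mulr_ge0 ?ltW.
have cx : 0 < c2 * x ^+ 2 by rewrite mulr_gt0// exprn_gt0.
have gx : 0 < gamma / K%:R * x ^+ 4 by apply: mulr_gt0 => //; rewrite exprn_gt0.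
have h3 : 0 <= y3 by apply: divr_ge0; [rewrite ler0n|exact: ltW].
have h5 : 0 <= y5 by apply: divr_ge0; [rewrite ler0n|exact: ltW].
have h4 : 0 <= y4 by apply: divr_ge0; [exact: mulr_ge0|exact: ltW].
have [L1 Ly1 Ly2 [Ly3 Ly4]] : [/\ 1 <= ln T%:R :> R, y1 <= ln T%:R, y2 <= ln T%:R &
    y3 <= ln T%:R /\ y4 <= ln T%:R] by split; [..|split]; lra.
exists (q ^ 3)%N; split.
- rewrite (leq_trans Kq)/=; first by rewrite (leq_trans _ qT)// leq_pexp2l.
  by rewrite expnS leq_pmulr// expn_gt0 q0.
- rewrite -ler_pdivrMl// (@le_trans _ _ (q ^ 4)%:R)//; last by rewrite ler_nat.
  by rewrite (expnS q 3) natrM ler_wpM2r.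
move=> A Y w hebs good t a /andP[qt tT].
have NL : c2 * ln T%:R ^+ 2 / 32 <= (pulls A a t w)%:R.
  exact: (pulls_ge_sqr_ln hK hgamma hmu hebs good Kq qT Tq L1 Ly1 Ly2 a qt).
have L0 : 0 < ln T%:R :> R by exact: lt_le_trans L1.
have m0 : 0 < c2 * ln T%:R ^+ 2 / 32 by rewrite divr_gt0// mulr_gt0// exprn_gt0.
split.
  rewrite (le_trans (emp_mean_near good m0 tT NL))//.
  rewrite -[leRHS]ger0_norm ?(ltW x0)// -sqrtr_sqr ler_wsqrtr//.
  rewrite ler_pdivrMr//.
  have := Ly3; rewrite /y3 ler_pdivrMr// => h.
  have := ler_wpM2l (ltW L0) h; rewrite !expr2; lra.
rewrite /conf_radius conf_width_le//; apply: le_trans NL.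
have := Ly4; rewrite /y4 ler_pdivrMr// => h.
rewrite ler_pdivlMr// (le_trans h)// mulrC ler_pM2l//.
by rewrite expr2 ler_peMl// ltW.
Qed.

Local Notation G := (gain mu best (opt_weights mu)).

Let hbest' b : b != best -> mu b < mu best.
Proof. by move: b; apply/best_arm_Some. Qed.

(* The weights are optimal for a vector with almost the gaps of [mu]: testing it
   against the optimal weights of [mu] avoids any continuity of the optimal weights. *)
Lemma near_optimal_weights (e l : R) nu : 0 < e < 1 -> 0 < l ->
  (forall b, b != best -> l <= mu best - mu b) ->
  best_arm nu = Some best -> (forall b, `|nu b - mu b| <= e * l / 2) ->
  (forall b, ((1 - e) * l / 2) ^+ 2 / (2 * K%:R) <= opt_weights nu b) /\
  (forall b, b != best -> (1 - e) ^+ 2 * G <=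
    2^-1 * (hprod (opt_weights nu best) (opt_weights nu b) *
      ((1 + e) * (mu best - mu b)) ^+ 2)).
Proof.
move=> /andP[e0 e1] l0 lP nub nun.
have gap b : b != best ->
    (1 - e) * (mu best - mu b) <= nu best - nu b <= (1 + e) * (mu best - mu b).
  move=> bb; have := nun b; have := nun best; rewrite !ler_norml => /andP[? ?] /andP[? ?].
  have : e * l <= e * (mu best - mu b) by rewrite ler_wpM2l ?lP// ltW.
  by move=> ?; apply/andP; split; rewrite ?mulrDl ?mulrBl; lra.
have e1' : 0 < 1 - e by lra.
split.
  apply: (opt_weights_ge hK nub) => [|b bb]; first by rewrite mulr_gt0.
  have /andP[g1 g2] := gap b bb.
  have /andP[mb0 mb1] := hmu b; have /andP[ma0 ma1] := hmu best.
  rewrite (le_trans _ g1)/=; last by rewrite ler_pM2l// lP.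
  rewrite (le_trans g2)//.
  have : (1 + e) * (mu best - mu b) <= 2 * 1 by rewrite ler_pM//; have := hbest' bb; lra.
  lra.
move=> b bb; have [[sv1 sv2] vmax] := opt_weights_max hK nub.
set v := opt_weights nu in sv1 sv2 vmax *.
have v0 c : 0 <= v c by have /andP[] := sv1 c.
have [[sm1 sm2] _] := opt_weights_max hK hbest.
have m0 c : 0 <= opt_weights mu c by have /andP[] := sm1 c.
have hG : (1 - e) ^+ 2 * G <= gain nu best v.
  apply: le_trans (vmax _ (opt_weights_simplex hK mu)).
  apply: le_gain => // c cb; have /andP[g1 _] := gap c cb.
  have := gain_le mu (opt_weights mu) cb.
  set H := hprod _ _; have H0 : 0 <= H by exact: hprod_ge0.
  move=> hc; rewrite (le_trans (ler_wpM2l (sqr_ge0 (1 - e)) hc))//.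
  rewrite mulrCA ler_pM2l ?invr_gt0// mulrCA ler_wpM2l// -exprMn.
  rewrite lerXn2r ?nnegrE ?mulr_ge0 ?(ltW e1') ?subr_ge0 ?(ltW (hbest' cb))//.
  by move/best_arm_Some : nub => /(_ c cb)/ltW.
rewrite (le_trans hG)// (le_trans (gain_le nu v bb))// ler_pM2l ?invr_gt0//.
have /andP[g1 g2] := gap b bb.
have d0 : 0 <= nu best - nu b.
  by rewrite (le_trans _ g1)// mulr_ge0 ?(ltW e1')// subr_ge0 (ltW (hbest' bb)).
rewrite ler_wpM2l ?hprod_ge0// lerXn2r ?nnegrE//.
exact: le_trans g2.
Qed.

(** The losses are a factor 1 - e for the discarded rounds, 1 - e for tracking, (1 - e)^2 for the
    empirical gaps and ((1 - e) / (1 + e))^2 for the near-optimality of the weights. Their product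
    is at least 1 - 8 e = th. *)
Lemma Zstat_growth (th : R) : 0 < th < 1 -> exists T0, forall T, (T0 <= T)%N ->
  (K <= T)%N /\ forall A Y w, ebs_sampling A Y gamma -> good_trajectory A Y w T ->
    th * T%:R * G <= Zstat A Y T w.
Proof.
move=> /andP[th0 th1].
have [l l0 lP] := min_gap hK hbest.
have G0 : 0 < G by exact: max_gain_gt0.
pose e := (1 - th) / 8.
have e0 : 0 < e by rewrite /e; lra.
have e1 : e < 8^-1 by rewrite /e; lra.
have em1 : 0 < 1 - e by lra.
have l1 : l <= 1.
  have [b bb] := other_arm hK best; have := lP b bb.
  have /andP[mb0 mb1] := hmu b; have /andP[ma0 ma1] := hmu best; lra.
(* Estimation error and radius add up to 2 x = e l / 2, the precision that [near_optimal_weights]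
   asks for. *)
pose x := e * l / 4.
have x0 : 0 < x by rewrite divr_gt0// mulr_gt0.
have xe : x <= e by rewrite /x ler_pdivrMr// ler_pM2l//; lra.
(* This lower bound on the weights after [t0] makes the cumulated weights linear in T, so that the
   tracking loss K is at most a fraction [e] of them. *)
pose om := ((1 - e) * l / 2) ^+ 2 / (2 * K%:R).
have om0 : 0 < om.
  by rewrite divr_gt0 ?exprn_gt0 ?divr_gt0 ?mulr_gt0//; lra.
have [T1 T1P] := uniform_consistency x0.
pose T2 := (Num.truncn (K%:R / ((1 - e) * om * e))).+1.
exists (maxn T1 T2) => T; rewrite geq_max => /andP[/T1P [t0 [/andP[Kt0 t0T] t0x near]] T2T].
have KT := leq_trans Kt0 t0T.
split => // A Y w hebs good.
have T0' : 0 < T%:R :> R by rewrite ltr0n (leq_trans _ KT)// (leq_trans _ hK).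
pose n : R := T%:R - t0%:R.
have nT : (1 - e) * T%:R <= n.
  have : x * T%:R <= e * T%:R by rewrite ler_pM2r.
  by rewrite /n mulrBl; lra.
have KnE : K%:R <= e * (om * n).
  have e1' : 0 < (1 - e) * om * e by apply: mulr_gt0 => //; exact: mulr_gt0.
  have : K%:R <= T%:R * ((1 - e) * om * e).
    rewrite -ler_pdivrMr// (le_trans (ltW (truncnS_gt _)))// ler_nat.
    exact: T2T.
  move=> /le_trans; apply.
  have -> : T%:R * ((1 - e) * om * e) = e * (om * ((1 - e) * T%:R)) by ring.
  by rewrite !ler_pM2l.
pose ws s := ebs_weights A Y gamma s w.
have ws0 s a : 0 <= ws s a.
  by have [/(_ a)/andP[]] := ebs_weights_simplex hK A Y gamma w s.
have wsP s : (t0 < s <= T)%N ->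
    (forall b, om <= ws s b) /\
    (forall b, b != best -> (1 - e) ^+ 2 * G <=
      2^-1 * (hprod (ws s best) (ws s b) * ((1 + e) * (mu best - mu b)) ^+ 2)).
  move=> /andP[ts sT].
  have st : (t0 <= s <= T)%N by rewrite ltnW.
  have Ks : (K <= s)%N by exact: leq_trans (ltnW ts).
  have nr a := near A Y w hebs good s a st.
  have rad a := conf_interval_nonempty hK hgamma hebs w a Ks.
  have -> : ws s = (exploration_biased_weights
      (fun a => emp_mean A Y a s w - conf_radius A gamma a s w)
      (fun a => emp_mean A Y a s w + conf_radius A gamma a s w)).2.
    by rewrite /ws /ebs_weights ltnNge Ks.
  have [||||nu [-> nub nun]] := @ebw_near R K hK mu best
    (fun a => emp_mean A Y a s w - conf_radius A gamma a s w)
    (fun a => emp_mean A Y a s w + conf_radius A gamma a s w) (e * l / 2).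
  - by move=> b; have := rad b; lra.
  - by move=> b; have [] := nr b; rewrite ler_norml /x => /andP[? ?] ?; lra.
  - by move=> b; have [] := nr b; rewrite ler_norml /x => /andP[? ?] ?; lra.
  - move=> b bb; have := lP b bb.
    have : e * l < 8^-1 * l by rewrite ltr_pM2r.
    lra.
  by apply: (@near_optimal_weights e l) => //; rewrite e0; lra.
pose W a := \sum_(t0.+1 <= s < T.+1) ws s a.
have sum_n (c : R) : \sum_(t0.+1 <= s < T.+1) c = n * c.
  by rewrite sumr_const_nat subSS -mulr_natl natrB.
have WN a : (1 - e) * W a <= (pulls A a T w)%:R.
  apply: le_trans (pulls_ge_tail hK hebs w t0 a KT); rewrite -/(W a).
  suff : om * n <= W a.
    move=> h; have : e * (om * n) <= e * W a by rewrite ler_pM2l.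
    by rewrite mulrBl; lra.
  rewrite mulrC -sum_n /W !big_nat; apply: ler_sum => s sI.
  by have [] := wsP s sI.
have n0 : 0 < n by rewrite (lt_le_trans _ nT)// mulr_gt0//; lra.
have W0 a : 0 < W a.
  apply: (@lt_le_trans _ _ (n * om)); first exact: mulr_gt0.
  by rewrite -sum_n /W !big_nat; apply: ler_sum => s sI; have [] := wsP s sI.
apply: (@le_trans _ _ (inf [set Zpair A Y best b T w | b in [set b | b != best]])); last first.
  exact: (@le_sup_image R _ setT (fun a => inf [set Zpair A Y a b T w | b in [set b | b != a]])).
apply: le_inf_image => [|b /= bb]; first by have [b bb] := other_arm hK best; exists b.
set De := mu best - mu b.
have De0 : 0 < De by rewrite subr_gt0 hbest'.
have lDe : l <= De by exact: lP.
pose X := 2^-1 * (hprod (W best) (W b) * De ^+ 2).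
have X0 : 0 <= X.
  by rewrite mulr_ge0 ?invr_ge0// mulr_ge0 ?sqr_ge0// hprod_ge0// ltW.
have nX : n * ((1 - e) ^+ 2 * G) <= (1 + e) ^+ 2 * X.
  have -> : (1 + e) ^+ 2 * X = 2^-1 * ((1 + e) * De) ^+ 2 * hprod (W best) (W b).
    by rewrite /X; ring.
  apply: (@le_trans _ _ (2^-1 * ((1 + e) * De) ^+ 2 *
      \sum_(t0.+1 <= s < T.+1) hprod (ws s best) (ws s b))); last first.
    by rewrite ler_wpM2l ?hprod_sum// mulr_ge0 ?invr_ge0// sqr_ge0.
  rewrite -sum_n mulr_sumr !big_nat; apply: ler_sum => s sI.
  have [_ /(_ b bb)] := wsP s sI; rewrite -/De.
  by rewrite [X in _ -> _ <= X](_ : _ = 2^-1 * (hprod (ws s best) (ws s b) * ((1 + e) * De) ^+ 2)); [|ring].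
have ZX : (1 - e) ^+ 3 * X <= Zpair A Y best b T w.
  rewrite /Zpair -/(hprod _ _).
  set D := emp_mean A Y best T w - emp_mean A Y b T w.
  have tTT : (t0 <= T <= T)%N by rewrite t0T leqnn.
  have [D1 _] := near A Y w hebs good T best tTT.
  have [D2 _] := near A Y w hebs good T b tTT.
  have DD : (1 - e) * De <= D.
    move: D1 D2; rewrite !ler_norml /x => /andP[? ?] /andP[? ?].
    have : e * l <= e * De by rewrite ler_pM2l.
    have : 0 < e * l by rewrite mulr_gt0.
    by rewrite mulrBl /D /De; lra.
  have eD0 : 0 < (1 - e) * De by rewrite mulr_gt0.
  have D0 : 0 < D by exact: lt_le_trans DD.
  rewrite (gtr0_norm D0) -expr2.
  have -> : (1 - e) ^+ 3 * X = 2^-1 * hprod ((1 - e) * W best) ((1 - e) * W b) *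
      ((1 - e) * De) ^+ 2 by rewrite hprodZ /X; ring.
  apply: ler_pM; rewrite ?sqr_ge0//.
  - by rewrite mulr_ge0 ?invr_ge0// hprod_ge0// ltW// mulr_gt0.
  - by rewrite ler_pM2l ?invr_gt0// hprod_mono// mulr_gt0.
  - by rewrite lerXn2r ?nnegrE ?(ltW D0) ?(ltW eD0).
apply: le_trans ZX.
have ep : 0 < (1 + e) ^+ 2 by rewrite exprn_gt0//; lra.
rewrite -(ler_pM2l ep).
have h1 : (1 - e) ^+ 3 * ((1 - e) * T%:R * ((1 - e) ^+ 2 * G)) <=
    (1 - e) ^+ 3 * ((1 + e) ^+ 2 * X).
  rewrite ler_pM2l ?exprn_gt0//; apply: le_trans nX.
  by rewrite ler_pM2r// mulr_gt0// exprn_gt0.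
have h2 : th * (1 + e) ^+ 2 <= (1 - e) ^+ 6.
  have -> : th = 1 - 8 * e by rewrite /e; lra.
  have b2 : 1 - 2 * e <= (1 - e) ^+ 2.
    by have := sqr_ge0 e; rewrite sqrrB !expr2 mulr1 mul1r mulr2n; lra.
  have b4 : 1 - 4 * e <= (1 - e) ^+ 4.
    have -> : (1 - e) ^+ 4 = (1 - e) ^+ 2 * (1 - e) ^+ 2 by ring.
    have : (1 - 2 * e) * (1 - 2 * e) <= (1 - e) ^+ 2 * (1 - e) ^+ 2 by rewrite ler_pM//; lra.
    by have := sqr_ge0 e; nra.
  have b6 : 1 - 6 * e <= (1 - e) ^+ 6.
    have -> : (1 - e) ^+ 6 = (1 - e) ^+ 4 * (1 - e) ^+ 2 by ring.
    have : (1 - 4 * e) * (1 - 2 * e) <= (1 - e) ^+ 4 * (1 - e) ^+ 2 by rewrite ler_pM//; lra.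
    by have := sqr_ge0 e; nra.
  apply: le_trans b6.
  have -> : (1 - 8 * e) * (1 + e) ^+ 2 = 1 - 6 * e - e ^+ 2 * (15 + 8 * e) by ring.
  have : 0 <= e ^+ 2 * (15 + 8 * e) by rewrite mulr_ge0 ?sqr_ge0//; lra.
  lra.
have TG : 0 < T%:R * G by rewrite mulr_gt0.
have -> : (1 + e) ^+ 2 * (th * T%:R * G) = th * (1 + e) ^+ 2 * (T%:R * G) by ring.
have -> : (1 + e) ^+ 2 * ((1 - e) ^+ 3 * X) = (1 - e) ^+ 3 * ((1 + e) ^+ 2 * X) by ring.
apply: le_trans h1; apply: (@le_trans _ _ ((1 - e) ^+ 6 * (T%:R * G))).
  by rewrite ler_pM2r.
by rewrite le_eqVlt; apply/orP; left; apply/eqP; ring.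
Qed.

End Asymptotics.

(** * Stopping time *)

Section StoppingTime.
Context {R : realType} {K : nat} {d : measure_display} {Omega : measurableType d}.

Lemma stopping_time_ge0 (A : nat -> Omega -> 'I_K) (Y : nat -> Omega -> R) beta w :
  (0 <= stopping_time A Y beta w)%E.
Proof. by apply: le_ereal_inf_tmp => _ [t _ <-]; rewrite lee_fin. Qed.

(** ln u <= u - 1 at u = eta T, where alpha * eta = c / 2, bounds alpha ln T by c T / 2 plus a
    constant; the other c T / 2 absorbs the constants. *)
Lemma threshold_lt (r alpha c : R) : 0 < r -> 0 < alpha -> 0 < c ->
  exists n : nat, forall T delta, (n <= T)%N -> 0 < delta ->
    threshold r alpha delta T < c * T%:R + ln (1 / delta).
Proof.
move=> r0 a0 c0; pose eta := c / (2 * alpha).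
have eta0 : 0 < eta by rewrite divr_gt0// mulr_gt0.
pose C := ln r - alpha - alpha * ln eta.
exists (maxn 1 (Num.truncn (2 * C / c)).+1) => T delta; rewrite geq_max => /andP[T1 CT] d0.
have T0 : 0 < T%:R :> R by rewrite ltr0n.
have {}CT : 2 * C < c * T%:R.
  by rewrite [ltRHS]mulrC -ltr_pdivrMr// (lt_le_trans (truncnS_gt _))// ler_nat.
rewrite /threshold div1r lnV ?posrE// ln_div ?posrE ?mulr_gt0 ?powR_gt0//.
rewrite lnM ?posrE ?powR_gt0// ln_powR ltrD2r.
have : ln (eta * T%:R) <= eta * T%:R - 1 by apply: ln_le; rewrite mulr_gt0.
rewrite lnM ?posrE// => /(ler_wpM2l (ltW a0)).
have -> : alpha * (eta * T%:R - 1) = c * T%:R / 2 - alpha.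
  by rewrite /eta; field; rewrite gt_eqF.
by rewrite mulrDr /C in CT *; lra.
Qed.

(** With [th] halfway between 1 / alpha and 1, the surplus (th - 1 / alpha) G T pays for the
    polynomial part of the threshold, and G T / alpha pays for ln (1 / delta). *)
Lemma stopping_time_le (gamma r alpha : R) (mu : 'I_K -> R) best :
  (2 <= K)%N -> 0 < gamma < 1 -> 0 < r -> 1 < alpha -> bandits mu ->
  best_arm mu = Some best ->
  exists n : nat, forall T delta, (n <= T)%N -> 0 < delta ->
    alpha / gain mu best (opt_weights mu) * ln (1 / delta) <= T%:R ->
    forall (A : nat -> Omega -> 'I_K) (Y : nat -> Omega -> R) w,
    ebs_sampling A Y gamma -> ~ deviation_event mu A Y T w ->
    (stopping_time A Y (threshold r alpha delta) w <= T%:R%:E)%E.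
Proof.
move=> hK hgamma r0 a1 hmu hbest.
set G := gain _ _ _; have G0 : 0 < G by exact: max_gain_gt0.
have a0 : 0 < alpha by lra.
have ai1 : alpha^-1 < 1 by rewrite invf_lt1.
have ai0 : 0 < alpha^-1 by rewrite invr_gt0.
pose th := (1 + alpha^-1) / 2.
have th01 : 0 < th < 1 by rewrite /th; lra.
have [n1 n1P] := @Zstat_growth R K d Omega hK gamma mu best hgamma hmu hbest th th01.
have c0 : 0 < G * (th - alpha^-1) by rewrite mulr_gt0// /th; lra.
have [n2 n2P] := threshold_lt r0 a0 c0.
exists (maxn n1 n2) => T delta; rewrite geq_max => /andP[/n1P[KT Zth] n2T] d0 lT A Y w hebs good.
apply: ge_ereal_inf; exists T%:R%:E => //; exists T => //; split => //.
apply: (@lt_le_trans _ _ (th * T%:R * G)); last first.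
  by apply: Zth => // t a tT; exact: deviation_le.
apply: lt_le_trans (n2P T delta n2T d0) _.
have {}lT : ln (1 / delta) <= T%:R * (G / alpha).
  by rewrite -ler_pdivrMr ?divr_gt0// invf_div mulrC.
have -> : th * T%:R * G = G * (th - alpha^-1) * T%:R + T%:R * (G / alpha) by ring.
by rewrite lerD2l.
Qed.

(** If m is the first non-exceptional horizon from [N0] on, then tau <= m and the m - N0 horizons
    before it are all counted. Without such an m the count is infinite, which also covers an
    infinite tau. *)
Lemma le_count_bad_events (D : nat -> set Omega) (N0 : nat) (tau : \bar R) w :
  (0 < N0)%N -> (forall T, (N0 <= T)%N -> ~ D T w -> (tau <= T%:R%:E)%E) ->
  (tau <= N0%:R%:E + \sum_(n <oo) (\1_(D n.+1) w)%:E)%E.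
Proof.
case: N0 => // M _ htau; set X := (\sum_(n <oo) _)%E.
have count j : (forall i, (i < j)%N -> D (M.+1 + i)%N w) -> (j%:R%:E <= X)%E.
  move=> hj; apply: (@le_trans _ _ (\sum_(0 <= n < M + j) (\1_(D n.+1) w)%:E)%E); last first.
    by apply: nneseries_lim_ge => n _ _; rewrite lee_fin.
  elim: j hj => [|j ih] hj; first by apply: sume_ge0 => n _; rewrite lee_fin.
  rewrite addnS big_nat_recr//= -natr1 EFinD leeD//; first by apply: ih => i /leqW; exact: hj.
  by rewrite lee_fin indicE mem_set// -addSn; exact: hj.
have [[T MT nD]|allD] := pselect (exists2 T, (M < T)%N & ~ D T w).
  pose p T := (M < T)%N && `[< ~ D T w >].
  have pT : exists T, p T by exists T; rewrite /p MT; apply/asboolP.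
  have [m /andP[Mm /asboolP mD] mmin] := ex_minnP pT.
  rewrite (le_trans (htau m Mm mD))//.
  have -> : m = (M.+1 + (m - M.+1))%N by rewrite subnKC.
  rewrite natrD EFinD leeD2l//; apply: count => i im.
  apply: contrapT => nDi; have : p (M.+1 + i)%N by rewrite /p leq_addr; apply/asboolP.
  by move=> /mmin; rewrite leqNgt -ltn_subRL im.
suff -> : X = +oo%E by rewrite addey// leey.
apply/eqyP => x x0.
apply: (@le_trans _ _ (Num.truncn x).+1%:R%:E).
  by rewrite lee_fin ltW// truncnS_gt.
apply: count => i _; apply: contrapT => nDi; apply: allD.
by exists (M.+1 + i)%N => //; rewrite leq_addr.
Qed.

(* The integral of a nonnegative function is defined as a supremum over the simple
   functions below it, whether or not it is measurable. *)
Lemma ge0_le_integral_nonmeasurable (P : {measure set Omega -> \bar R})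
    (f g : Omega -> \bar R) :
  (forall w, 0 <= f w)%E -> (forall w, f w <= g w)%E ->
  (\int[P]_w f w <= \int[P]_w g w)%E.
Proof.
move=> f0 fg; have g0 w : (0 <= g w)%E by exact: le_trans (fg w).
rewrite !ge0_integralTE//; apply: ge_ereal_sup => _ [h/= hf <-].
by apply: ereal_sup_ubound; exists h => //= w; exact: le_trans (fg w).
Qed.

Lemma expected_stopping_time_le (P : probability Omega R) (gamma r alpha : R)
    (mu : 'I_K -> R) best :
  (2 <= K)%N -> 0 < gamma < 1 -> 0 < r -> 1 < alpha -> bandits mu ->
  best_arm mu = Some best ->
  exists C : R, forall (A : nat -> Omega -> 'I_K) (Y : nat -> Omega -> R) delta,
    0 < delta < 1 -> bandit_interaction A Y P mu -> ebs_sampling A Y gamma ->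
    (\int[P]_w stopping_time A Y (threshold r alpha delta) w <=
      (alpha / gain mu best (opt_weights mu) * ln (1 / delta) + C)%:E)%E.
Proof.
move=> hK hgamma r0 a1 hmu hbest.
have [n nP] := stopping_time_le hK hgamma r0 a1 hmu hbest.
set G := gain _ _ _ in nP *; have G0 : 0 < G by exact: max_gain_gt0.
(* [n] is where the asymptotic regime starts, 1 pays for rounding, and 16 K bounds the expected
   number of exceptional horizons. *)
exists (n%:R + 1 + 16 * K%:R) => A Y delta /andP[d0 d1] hb hebs.
pose l := alpha / G * ln (1 / delta).
have l0 : 0 <= l.
  rewrite mulr_ge0 ?divr_ge0 ?ltW//; first by lra.
  by rewrite ln_gt0// mul1r invf_gt1.
pose N0 := (maxn n (Num.truncn l)).+1.
have N0l : N0%:R <= l + n%:R + 1.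
  rewrite -natr1 lerD2r; have [_|_] := leqP n (Num.truncn l).
    by have /andP[tl _] := truncn_itv l0; rewrite (le_trans tl)// lerDl.
  by rewrite lerDr.
apply: (@le_trans _ _ (\int[P]_w (N0%:R%:E +
    \sum_(T <oo) (\1_(deviation_event mu A Y T.+1) w)%:E))%E).
  apply: ge0_le_integral_nonmeasurable => w; first exact: stopping_time_ge0.
  apply: le_count_bad_events => // T N0T; apply: nP => //.
    by rewrite (leq_trans _ N0T)// leqW// leq_maxl.
  apply: (le_trans (ltW (truncnS_gt _))); rewrite ler_nat.
  by apply: leq_trans N0T; rewrite ltnS leq_maxr.
rewrite ge0_integralD//; last 2 first.
- by move=> w _; apply: nneseries_ge0 => T _ _; rewrite lee_fin.
- apply: ge0_emeasurable_sum => T; first by move=> w _ _; rewrite lee_fin.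
  by move=> _; apply/measurable_EFinP; apply: measurable_indic; exact: deviation_event_measurable hb _.
have -> : (\int[P]_w N0%:R%:E = N0%:R%:E)%E.
  by rewrite integral_cst// -[RHS]mule1; congr (_ * _)%E; exact: probability_setT.
apply: (@le_trans _ _ (N0%:R%:E + (16 * K%:R)%:E)%E).
  by rewrite leeD2l//; exact: deviation_count_integral.
by rewrite -EFinD lee_fin -/l; lra.
Qed.

End StoppingTime.

Theorem theorem6 (R : realType) (K : nat) (gamma alpha r : R) (mu : 'I_K -> R)
  (d : measure_display) (Omega : measurableType d) (P : probability Omega R)
  (A : R -> nat -> Omega -> 'I_K) (Y : R -> nat -> Omega -> R)
  (hK : (2 <= K)%N)
  (hgamma : 0 < gamma < 1)
  (halpha : 1 < alpha <= expR 1 / 2)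
  (hr : 0 < r)
  (hmu : bandits_star mu)
  (hbandit : forall delta, 0 < delta < 1 ->
     bandit_interaction (A delta) (Y delta) P mu)
  (hebs : forall delta, 0 < delta < 1 ->
     ebs_sampling (A delta) (Y delta) gamma) :
  (limf_esup (fun delta : R =>
     (\int[P]_w stopping_time (A delta) (Y delta) (threshold r alpha delta) w)
       * ((ln (1 / delta))^-1)%:E) 0^'+
   <= (alpha * char_time mu)%:E)%E.
Proof.
have [mu01 muP] := hmu; have /andP[a1 _] := halpha.
case muE : (best_arm mu) muP => [best|]// _.
have [C CP] := expected_stopping_time_le P hK hgamma hr a1 mu01 muE.
set G := gain _ _ _ in CP.
apply: (@le_trans _ _ (alpha / G)%:E); last first.
  by rewrite lee_fin ler_pM2l ?(lt_trans ltr01)// char_time_ge.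
apply/lee_addgt0Pr => e e0.
(* Below [d0], ln (1 / delta) is at least |C| / e + 1: it is positive, and the additive constant
   contributes at most [e] after division. *)
pose d0 : R := expR (- (`|C| / e + 1)).
have d01 : d0 < 1.
  rewrite -[ltRHS]expR0 ltr_expR oppr_lt0.
  by rewrite ltr_wpDl// divr_ge0// ltW.
rewrite limf_esupE; apply: ge_ereal_inf.
exists (ereal_sup ((fun delta : R =>
     (\int[P]_w stopping_time (A delta) (Y delta) (threshold r alpha delta) w)
       * ((ln (1 / delta))^-1)%:E)%E @` [set delta : R | 0 < delta < d0])).
  exists [set delta : R | 0 < delta < d0] => //.
  near=> delta; apply/andP; split.
    by near: delta; exact: nbhs_right_gt.
  by near: delta; apply: nbhs_right_lt; exact: expR_gt0.
apply: ge_ereal_sup => _ [delta /= /andP[delta0 deltad] <-].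
have delta1 : 0 < delta < 1 by rewrite delta0 (lt_trans deltad).
have lnd : `|C| / e + 1 <= ln (1 / delta).
  rewrite mul1r lnV ?posrE// lerNr -[leRHS]expRK ler_ln ?posrE ?expR_gt0//.
  exact: ltW.
have Ce : 0 <= `|C| / e by rewrite divr_ge0// ltW.
have l0 : 0 < ln (1 / delta) by lra.
apply: (@le_trans _ _ ((alpha / G * ln (1 / delta) + C)%:E * ((ln (1 / delta))^-1)%:E)%E).
  apply: lee_wpmul2r; first by rewrite lee_fin invr_ge0 ltW.
  exact: CP _ _ _ delta1 (hbandit _ delta1) (hebs _ delta1).
rewrite -EFinM -EFinD lee_fin mulrDl mulfK ?gt_eqF// lerD2l ler_pdivrMr//.
rewrite (le_trans (ler_norm C))// mulrC -ler_pdivrMr//; lra.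
Unshelve. all: by end_near.
Qed.
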